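(* Let $\lambda,\mu$ be partitions with at most $n$ parts and $\mathbf r,\mathbf s\in\mathbb Z_{>0}^n$ such that $r_i\le r_{i+1}$ and $s_i\le s_{i+1}$ whenever $\mu_i<\lambda_{i+1}$ ($1\le i\le n-1$). Then \[ g^{\mathrm{row}(\mathbf r,\mathbf s)}_{\lambda/\mu}(\mathbf x;\boldsymbol\alpha,\boldsymbol\beta)=\det\Big(h_{\lambda_i-\mu_j-i+j}\big[X_{[r_j,s_i]}-A_{\lambda_i-1}+A_{\mu_j}+B_{i-1}-B_{j-1}\big]\Big)_{i,j=1}^n, \] \[ g^{\mathrm{col}(\mathbf r,\mathbf s)}_{\lambda'/\mu'}(\mathbf x;\boldsymbol\alpha,\boldsymbol\beta)=\det\Big(e_{\lambda_i-\mu_j-i+j}\big[X_{[r_j,s_i]}-A_{i-1}+A_{j-1}+B_{\lambda_i-1}-B_{\mu_j}\big]\Big)_{i,j=1}^n. \]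
   Context: $\lambda',\mu'$ are transposes. Parameters $\boldsymbol\alpha,\boldsymbol\beta$; $A_k=\alpha_1+\dots+\alpha_k$, $B_k=\beta_1+\dots+\beta_k$ for $k\ge1$, $A_k=B_k=0$ for $k\le0$; $X_{[r,s]}=x_r+\dots+x_s$ ($=0$ if $r>s$). For a formal $\mathbb Z$-linear combination $Z=\sum_uc_uu$ of variables/parameters, $\sum_m h_m[Z]t^m=\prod_u(1-ut)^{-c_u}$, $\sum_m e_m[Z]t^m=\prod_u(1+ut)^{c_u}$, and $h_m[Z]=e_m[Z]=0$ for $m<0$. A (left-)marked reverse plane partition of shape $\nu/\rho$ ($\rho\subseteq\nu$) is a filling $T$ by positive integers weakly increasing along rows and columns, in which each $T(i,j)$ with $(i,j+1)$ in the shape and $T(i,j)=T(i,j+1)$ may be marked. Weight $\mathrm{wt}(T)=\prod_{(i,j)}w(i,j)$: $w=-\alpha_j$ if $T(i,j)$ marked; $w=\beta_{i-1}$ if unmarked, $(i-1,j)$ in the shape and $T(i,j)=T(i-1,j)$; $w=x_{T(i,j)}$ otherwise. $g^{\mathrm{row}(\mathbf r,\mathbf s)}_{\lambda/\mu}$ is the sum of weights over those with $r_i\le T(i,j)\le s_i$ for all cells; $g^{\mathrm{col}(\mathbf r,\mathbf s)}_{\lambda'/\mu'}$ the sum over those of shape $\lambda'/\mu'$ with $r_j\le T(i,j)\le s_j$. By convention these are $0$ when the inner partition is not contained in the outer one. *)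

(* Defs.v *)
From HB Require Import structures.
From mathcomp Require Import all_boot all_order all_algebra.
From mathcomp Require Export freeg.

Set Implicit Arguments.
Unset Strict Implicit.
Unset Printing Implicit Defensive.

Import Order.TTheory GRing.Theory Num.Theory.
Local Open Scope ring_scope.

(** Variables and parameters are elements of an arbitrary commutative ring [R];
    the identity between polynomials is the instance in which [R] is a
    polynomial ring. The families [x], [a], [b] are indexed from 1 (their value
    at 0 is never used), while rows and columns of diagrams are indexed from 0. *)

(** * Formal power series, as coefficient sequences *)

Section PowerSeries.
Variable R : comNzRingType.
Implicit Types (f g : nat -> R) (u : R).

Definition fps1 : nat -> R := fun m => (m == 0%N)%:R.

Definition fps_mul f g : nat -> R := fun m => \sum_(k < m.+1) f k * g (m - k)%N.

(** [1 + u t] *)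
Definition fps_lin u : nat -> R :=
  fun m => if m is m'.+1 then (if m' is 0%N then u else 0) else 1.

Definition fps_lin_inv u : nat -> R := fun m => (- u) ^+ m.

Lemma fps_lin_mulV u m : fps_mul (fps_lin u) (fps_lin_inv u) m = fps1 m.
Proof.
case: m => [|m]; first by rewrite /fps_mul big_ord1 mul1r.
rewrite /fps_mul 2!big_ord_recl big1 => [|i _]; last by rewrite mul0r.
rewrite /fps_lin /fps_lin_inv /fps1 /= mul1r addr0 subn0 subn1 exprS mulNr /=.
by rewrite addNr.
Qed.

(** [(1 + u t) ^ c] for an integer [c] *)
Definition fps_lin_exp u (c : int) : nat -> R :=
  match c with
  | Posz k => iter k (fps_mul (fps_lin u)) fps1
  | Negz k => iter k.+1 (fps_mul (fps_lin_inv u)) fps1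
  end.

End PowerSeries.

(** * Plethystic notation *)

Section Plethysm.
Variable R : comNzRingType.
Implicit Types (Z : {freeg R / int}) (x : nat -> R).

(** The keys of [Z] are elements of [R], so variables with equal values are
    merged in [Z]; the products below do not see the difference, being
    multiplicative in [Z]. *)
Definition h_series Z : nat -> R :=
  \big[@fps_mul R/@fps1 R]_(u <- dom Z) fps_lin_exp (- u) (- coeff u Z).

Definition e_series Z : nat -> R :=
  \big[@fps_mul R/@fps1 R]_(u <- dom Z) fps_lin_exp u (coeff u Z).

Definition h (m : int) Z : R := if m is Posz k then h_series Z k else 0.
Definition e (m : int) Z : R := if m is Posz k then e_series Z k else 0.

(** [x_r + ... + x_s] as a formal sum, empty if [r > s] *)
Definition alph x (r s : nat) : {freeg R / int} :=
  \sum_(r <= k < s.+1) << x k >>.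

(** [x_1 + ... + x_k] as a formal sum. It vanishes at [k = 0], so truncated
    predecessors may be used for indices that could be negative. *)
Definition psum x (k : nat) : {freeg R / int} := alph x 1 k.

End Plethysm.

(** * Partitions, as weakly decreasing sequences with optional trailing zeros *)

Definition is_part (l : seq nat) : bool := sorted geq l.

Definition conj_part (l : seq nat) : seq nat :=
  mkseq (fun j => count (fun p => j < p)%N l) (head 0%N l).

Definition part_sub (rho nu : seq nat) : bool :=
  all (fun i => nth 0 rho i <= nth 0 nu i)%N (iota 0 (size rho)).

(** * Marked reverse plane partitions *)

(** The cells of [nu / rho], as pairs (row, column) *)
Definition in_skew (nu rho : seq nat) (c : 'I_(size nu) * 'I_(head 0%N nu)) : bool :=
  (nth 0 rho c.1 <= c.2 < nth 0 nu c.1)%N.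

Definition cell (nu rho : seq nat) : finType :=
  {c : 'I_(size nu) * 'I_(head 0%N nu) | in_skew rho c}.

Section MarkedRPP.
Variables (nu rho : seq nat).
Implicit Types (c d : cell nu rho).

Definition crow c : nat := (val c).1.
Definition ccol c : nat := (val c).2.

Section Filling.
Variables (N : nat) (T : {ffun cell nu rho -> 'I_N}) (M : {set cell nu rho}).

Definition is_rpp : bool :=
  [forall c, (0 < T c)%N] &&
  [forall c, forall d,
     ((crow c == crow d) && (ccol c <= ccol d)%N ||
      (ccol c == ccol d) && (crow c <= crow d)%N) ==> (T c <= T d)%N].

Definition eq_right c : bool :=
  [exists d, [&& crow d == crow c, ccol d == (ccol c).+1 & T d == T c]].

Definition eq_above c : bool :=
  [exists d, [&& crow c == (crow d).+1, ccol d == ccol c & T d == T c]].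

(** [M] is the set of marked cells. *)
Definition is_mrpp : bool := is_rpp && [forall c in M, eq_right c].

Variables (R : comNzRingType) (x a b : nat -> R).

(** Row [i] in 1-based numbering is [crow c = i - 1], whence [b (crow c)] for
    [b_(i-1)] and [a (ccol c).+1] for [a_j]. *)
Definition cell_wt c : R :=
  if c \in M then - a (ccol c).+1
  else if eq_above c then b (crow c)
  else x (T c).

Definition wt : R := \prod_c cell_wt c.

End Filling.

Variables (R : comNzRingType) (x a b : nat -> R).

(** The generating function of marked reverse plane partitions [(T, M)] of shape
    [nu / rho] with [lo c <= T c <= hi c] for all cells [c]; the type of [T]
    only imposes the bound [max hi]. *)
Definition g_bounded (lo hi : cell nu rho -> nat) : R :=
  if part_sub rho nu then
    \sum_(T : {ffun cell nu rho -> 'I_(\max_c hi c).+1} |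
            [forall c, (lo c <= T c <= hi c)%N])
      \sum_(M : {set cell nu rho} | is_mrpp T M) wt T M x a b
  else 0.

Definition g_row (r s : seq nat) : R :=
  g_bounded (fun c => nth 0%N r (crow c)) (fun c => nth 0%N s (crow c)).

Definition g_col (r s : seq nat) : R :=
  g_bounded (fun c => nth 0%N r (ccol c)) (fun c => nth 0%N s (ccol c)).

End MarkedRPP.

(* Main.v *)
(** Rows and columns are unified by a supersymmetric weight: a cell with value [v]
    in row [i] and column [j] weighs [(up ? b_i : y_v) + (next ? - a_j : z_v)], where
    [up] and [next] say that the cell above, resp. to the right, has the same value;
    on the determinantal side the letter [v] contributes [(1 + z_v t) / (1 - y_v t)].
    The row formula is the case [y = x, z = 0]. The column formula is the case
    [y = 0, z = x], with [e] in the role of [h], after the shape has been transposed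
    and rotated by 180 degrees and the order of the values reversed.

    For increasing flags both sides satisfy the same recursion, obtained by peeling
    off the cells of smallest value [v]. For fillings this is immediate. For the
    determinant, each column is first corrected by a multiple of the preceding one, so
    that it becomes the sum over the possible lengths of a run of [v]s in that row of
    the weight of the run times the column of the peeled shape; the part of this sum
    over runs that end beyond the row above is a multiple of the preceding column,
    hence only the partitions survive in the multilinear expansion. *)

From HB Require Import structures.
From Stdlib Require Import FunctionalExtensionality.
Require Import Defs.
From mathcomp Require Import all_boot all_order all_algebra.
From mathcomp Require Import fingroup perm zify ring.

Set Implicit Arguments.
Unset Strict Implicit.
Unset Printing Implicit Defensive.

Import Order.TTheory GRing.Theory Num.Theory.
Local Open Scope ring_scope.

(** * Plethysm *)

Section FormalSeries.
Variable R : comNzRingType.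
Implicit Types (f g k : nat -> R) (u : R).

(** Coefficients below [N] of a product depend only on these truncations, so the laws of [{poly R}]
    carry over to coefficient sequences. *)
Definition truncate N f : {poly R} := \poly_(i < N) f i.

Lemma coef_truncate N f i : (i < N)%N -> (truncate N f)`_i = f i.
Proof. by move=> lt_iN; rewrite coef_poly lt_iN. Qed.

Lemma fps_mulE N f g m : (m < N)%N -> fps_mul f g m = (truncate N f * truncate N g)`_m.
Proof.
move=> lt_mN; rewrite coefM; apply: eq_bigr => i _.
by rewrite !coef_truncate // (leq_ltn_trans _ lt_mN) ?leq_subr // -ltnS.
Qed.

Lemma fps_mulA : associative (@fps_mul R).
Proof.
have E f g k m : fps_mul f (fps_mul g k) m =
    (truncate m.+1 f * (truncate m.+1 g * truncate m.+1 k))`_m.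
  rewrite coefM; apply: eq_bigr => i _; rewrite coef_truncate //.
  by rewrite (@fps_mulE m.+1) // ltnS leq_subr.
have C f g : fps_mul f g = fps_mul g f.
  by apply: functional_extensionality => m; rewrite !(@fps_mulE m.+1) // mulrC.
move=> f g k; apply: functional_extensionality => m.
by rewrite (C (fps_mul f g) k) !E mulrA [in RHS]mulrC.
Qed.

Lemma fps_mulC : commutative (@fps_mul R).
Proof.
by move=> f g; apply: functional_extensionality => m; rewrite !(@fps_mulE m.+1) // mulrC.
Qed.

Lemma fps_mul1 : left_id (@fps1 R) (@fps_mul R).
Proof.
move=> f; apply: functional_extensionality => m.
rewrite /fps_mul big_ord_recl big1 ?addr0 ?subn0 ?mul1r // => i _.
by rewrite /fps1 /= mul0r.
Qed.

HB.instance Definition _ :=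
  Monoid.isComLaw.Build (nat -> R) (@fps1 R) (@fps_mul R) fps_mulA fps_mulC fps_mul1.

(** For a negative exponent the new factor cancels one copy of the inverse series, so the rule also
    holds across the change of sign. *)
Lemma fps_lin_expS u (c : int) :
  fps_lin_exp u (c + 1) = fps_mul (fps_lin u) (fps_lin_exp u c).
Proof.
case: c => [k|k]; first by rewrite -PoszD addn1.
have -> : Negz k + 1 = - k%:Z by rewrite NegzE -addn1 PoszD opprD addrNK.
rewrite [fps_lin_exp u (Negz k)]/= fps_mulA.
have -> : fps_mul (fps_lin u) (fps_lin_inv u) = @fps1 R.
  by apply: functional_extensionality => m; rewrite fps_lin_mulV.
by rewrite fps_mul1; case: k => [|k].
Qed.

Lemma fps_lin_mulE u f (m : nat) :
  fps_mul (fps_lin u) f m = f m + u * (if m is m'.+1 then f m' else 0).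
Proof.
rewrite /fps_mul big_ord_recl /= mul1r subn0.
case: m => [|m]; first by rewrite big_ord0 mulr0 !addr0.
rewrite big_ord_recl big1 ?addr0 /= ?subSS ?subn0 // => i _.
by rewrite mul0r.
Qed.
End FormalSeries.

Section Plethysm.
Variable R : comNzRingType.
Implicit Types (Z : {freeg R / int}) (u : R).

Lemma big_dom (F : R -> int -> nat -> R) Z (s : seq R) :
  (forall u, F u 0 = @fps1 R) -> uniq s -> {subset dom Z <= s} ->
  \big[@fps_mul R/@fps1 R]_(u <- dom Z) F u (coeff u Z)
  = \big[@fps_mul R/@fps1 R]_(u <- s) F u (coeff u Z).
Proof.
move=> F0 Us sub.
rewrite (bigID (fun u => u \in dom Z)) /= [X in _ = X](bigID (fun u => u \in dom Z)) /=.
congr (fps_mul _ _).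
  rewrite -big_filter -[RHS]big_filter; apply: perm_big; apply: uniq_perm.
  - by rewrite filter_uniq // uniq_dom.
  - by rewrite filter_uniq.
  by move=> u; rewrite !mem_filter; case: (boolP (u \in dom Z)) => //= /sub ->.
by rewrite !big1 // => u; rewrite mem_dom negbK => /eqP ->.
Qed.

(** Only the factor at [u] changes. Both products are taken over a common list of keys, because
    adding [<< u >>] may bring [u] into the domain or remove it. *)
Lemma big_domD1 (F : R -> int -> nat -> R) Z u (f : nat -> R) :
  (forall u, F u 0 = @fps1 R) -> F u (coeff u Z + 1) = fps_mul f (F u (coeff u Z)) ->
  \big[@fps_mul R/@fps1 R]_(w <- dom (Z + << u >>)) F w (coeff w (Z + << u >>))
  = fps_mul f (\big[@fps_mul R/@fps1 R]_(w <- dom Z) F w (coeff w Z)).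
Proof.
move=> F0 FS; pose s := undup (u :: dom Z ++ dom (Z + << u >>)).
have Us : uniq s by apply: undup_uniq.
have us : u \in s by rewrite mem_undup mem_head.
rewrite (@big_dom F (Z + << u >>) s F0 Us) ?(@big_dom F Z s F0 Us).
- rewrite !(big_rem _ us) /= fps_mulA -FS.
  rewrite coeffD coeffU eqxx mul1r; congr (fps_mul _ _).
  rewrite rem_filter // !big_filter; apply: eq_bigr => w /= neq_wu.
  by rewrite coeffD coeffU eq_sym (negPf neq_wu) mulr0 addr0.
- by move=> w wZ; rewrite mem_undup inE mem_cat wZ orbT.
- by move=> w wZ; rewrite mem_undup inE mem_cat wZ !orbT.
Qed.

Lemma e_addU m Z u : e m (Z + << u >>) = e m Z + u * e (m - 1) Z.
Proof.
have -> : e m (Z + << u >>) = if m is Posz k then fps_mul (fps_lin u) (e_series Z) k else 0.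
  case: m => // k; congr (_ k); apply: (@big_domD1 (@fps_lin_exp R)) => //.
  exact: fps_lin_expS.
case: m => [k|k]; last by rewrite /= mulr0 addr0.
rewrite fps_lin_mulE; case: k => [|k]; rewrite ?mulr0 //.
by rewrite -[k.+1%:Z - 1]/((k.+1 - 1)%N%:Z) subn1.
Qed.

(** Multiplying by [1 - u t] undoes the adjunction of [u]. In this direction the recurrence is
    finite; it is the form assumed of the abstract [H] below. *)
Lemma h_addU m Z u : h m Z = h m (Z + << u >>) - u * h (m - 1) (Z + << u >>).
Proof.
have E : h_series Z = fps_mul (fps_lin (- u)) (h_series (Z + << u >>)).
  have linV : fps_mul (fps_lin (- u)) (fps_lin_inv (- u)) = @fps1 R.
    by apply: functional_extensionality => k; rewrite fps_lin_mulV.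
  rewrite /h_series (@big_domD1 (fun w c => fps_lin_exp (- w) (- c)) _ _ (fps_lin_inv (- u))) //.
    by rewrite fps_mulA linV fps_mul1.
  rewrite -[- coeff u Z](subrK 1) fps_lin_expS fps_mulA [fps_mul (fps_lin_inv _) _]fps_mulC.
  by rewrite linV fps_mul1 opprD.
case: m => [k|k]; last by rewrite /= mulr0 subr0.
rewrite [LHS]/= E fps_lin_mulE mulNr; case: k => [|k]; rewrite ?mulr0 //.
by rewrite -[k.+1%:Z - 1]/((k.+1 - 1)%N%:Z) subn1.
Qed.

Lemma h_dom0 m : h m (0 : {freeg R / int}) = (m == 0)%:R.
Proof. by case: m => // k; rewrite /h /h_series dom0 big_nil. Qed.

Lemma e_dom0 m : e m (0 : {freeg R / int}) = (m == 0)%:R.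
Proof. by case: m => // k; rewrite /e /e_series dom0 big_nil. Qed.

Lemma fps_lin_exp0 (u : R) c : fps_lin_exp u c 0 = 1.
Proof.
have mul0 (f g : nat -> R) : f 0%N = 1 -> g 0%N = 1 -> fps_mul f g 0%N = 1.
  by move=> f0 g0; rewrite /fps_mul big_ord1 f0 g0 mulr1.
case: c => k; last by elim: k => [|k IHk]; rewrite /= mul0.
by elim: k => [|k IHk] //=; rewrite mul0.
Qed.

Lemma h_m0 Z : h 0 Z = 1.
Proof.
apply: (big_ind (fun f : nat -> R => f 0%N = 1)) => // [f g f0 g0|u _].
  by rewrite /fps_mul big_ord1 f0 g0 mulr1.
exact: fps_lin_exp0.
Qed.

Lemma e_m0 Z : e 0 Z = 1.
Proof.
apply: (big_ind (fun f : nat -> R => f 0%N = 1)) => // [f g f0 g0|u _].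
  by rewrite /fps_mul big_ord1 f0 g0 mulr1.
exact: fps_lin_exp0.
Qed.
End Plethysm.

(** * Determinants *)

(** A permutation contributes only if it never lowers [bl]; as it also preserves the sum of [bl], it
    preserves each block, and there the matrices agree. *)
Lemma det_eq_blocks (R : comNzRingType) n (bl : 'I_n -> nat) (A B : 'M[R]_n) :
  (forall i j, bl i = bl j -> A i j = B i j) ->
  (forall i j, (bl j < bl i)%N -> A i j = 0) ->
  (forall i j, (bl j < bl i)%N -> B i j = 0) -> \det A = \det B.
Proof.
move=> eqAB A0 B0; apply: eq_bigr => s _; congr (_ * _).
have [bl_le|/forallPn[i]] := boolP [forall i, (bl i <= bl (s i))%N]; last first.
  by rewrite -ltnNge => lt; rewrite [LHS](bigD1 i) // [RHS](bigD1 i) //= A0 ?B0 // !mul0r.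
have bl_eq i : bl i = bl (s i).
  have := leqif_sum (fun j (_ : true) => leqif_eq (forallP bl_le j)).
  rewrite [X in (_ <= X ?= iff _)%N](reindex_inj (@perm_inj _ s^-1%g)) /=.
  under [X in (_ <= X ?= iff _)%N]eq_bigr => j _ do rewrite permKV.
  by case=> _; rewrite eqxx => /esym/forallP/(_ i)/eqP.
by apply: eq_bigr => i _; apply: eqAB.
Qed.

(** A permutation avoiding the zeros would inject the [k + 1] rows up to [k] into the [k] columns
    before [k]. *)
Lemma det_zero_block (R : comNzRingType) n (k : 'I_n) (A : 'M[R]_n) :
  (forall i j : 'I_n, (i <= k)%N -> (k <= j)%N -> A i j = 0) -> \det A = 0.
Proof.
move=> A0; apply: big1 => s _.
have [/existsP[i /andP[ik ksi]]|] := boolP [exists i : 'I_n, (i <= k)%N && (k <= s i)%N].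
  by rewrite (bigD1 i) //= A0 // mul0r mulr0.
rewrite negb_exists => /forallP no.
have: (#|[set i : 'I_n | (i <= k)%N]| <= #|[set i : 'I_n | (i < k)%N]|)%N.
  rewrite -(card_imset _ (@perm_inj _ s)); apply/subset_leq_card/subsetP => j.
  case/imsetP => i + ->.
  by rewrite !inE => ik; move: (no i); rewrite ik /= -ltnNge.
rewrite leqNgt => /negP[]; apply: proper_card; apply/properP; split.
  by apply/subsetP => i; rewrite !inE => /ltnW.
by exists k; rewrite !inE // ltnn.
Qed.

Section MultilinearExpansion.
Variables (R : comNzRingType) (n Q : nat).
Implicit Types (f g : {ffun 'I_n -> 'I_Q.+1}) (c : nat -> nat -> 'I_n -> R).

(** The extension by 0 lets a decreasing choice of indices serve as a partition. *)
Definition fn f (i : nat) : nat := if insub i is Some j then f j else 0%N.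

Lemma fnE f (i : 'I_n) : fn f i = f i.
Proof. by rewrite /fn valK. Qed.

Lemma fn_out f i : (n <= i)%N -> fn f i = 0%N.
Proof. by move=> ni; rewrite /fn insubN // -leqNgt. Qed.

Lemma det_sum_columns (W : nat -> nat -> R) c :
  \det (\matrix_(i < n, j < n) \sum_(q < Q.+1) W j q * c j q i)
  = \sum_(f : {ffun 'I_n -> 'I_Q.+1}) \prod_(j < n) W j (f j) * \det (\matrix_(i < n, j < n) c j (f j) i).
Proof.
transitivity (\sum_(s : 'S_n) (-1) ^+ s *
    \sum_(f : {ffun 'I_n -> 'I_Q.+1}) \prod_(j < n) (W j (f j) * c j (f j) (s j))).
  rewrite -det_tr; apply: eq_bigr => s _; congr (_ * _).
  rewrite -(bigA_distr_bigA (fun (j : 'I_n) (q : 'I_Q.+1) => W j q * c j q (s j))).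
  by apply: eq_bigr => j _; rewrite !mxE.
under eq_bigr => s _ do rewrite mulr_sumr.
rewrite exchange_big; apply: eq_bigr => f _.
rewrite -det_tr mulr_sumr; apply: eq_bigr => s _.
rewrite big_split /= mulrCA; congr (_ * (_ * _)).
by apply: eq_bigr => j _; rewrite !mxE.
Qed.

Definition chain_upto k f := [forall i : 'I_n, (i.+1 < k)%N ==> (fn f i.+1 <= fn f i)%N].

Definition upd f (k : 'I_n) (q : 'I_Q.+1) := [ffun j => if j == k then q else f j].

Lemma fn_upd f k q (i : nat) : fn (upd f k q) i = if i == k then (q : nat) else fn f i.
Proof.
rewrite /fn; case: insubP => [j lt_in <-|ni]; first by rewrite ffunE -val_eqE; case: eqP.
by case: eqP ni => // ->; rewrite ltn_ord.
Qed.

(* The indices [f] with [f k < f k.+1] cancel: summed over [f k.+1], they give a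
   matrix in which column [k.+1] is a multiple of column [k]. *)
Lemma det_sum_chains (W : nat -> nat -> R) c (nu : nat -> nat) :
  (forall j q, (q < nu j)%N -> W j q = 0) ->
  (forall j m, (j.+1 < n)%N -> (nu j <= m)%N -> exists kap, forall i,
     \sum_(q < Q.+1 | (m < q)%N) W j.+1 q * c j.+1 q i = kap * c j m i) ->
  \det (\matrix_(i < n, j < n) \sum_(q < Q.+1) W j q * c j q i)
  = \sum_(f : {ffun 'I_n -> 'I_Q.+1} | chain_upto n f)
      \prod_(j < n) W j (f j) * \det (\matrix_(i < n, j < n) c j (f j) i).
Proof.
move=> W0 tail; rewrite det_sum_columns.
pose F (f : {ffun 'I_n -> 'I_Q.+1}) :=
  \prod_(j < n) W j (f j) * \det (\matrix_(i < n, j < n) c j (f j) i).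
rewrite -[LHS]/(\sum_f F f) -[RHS]/(\sum_(f | chain_upto n f) F f).
(* Induction on [k]: the sum may be restricted to those [f] that decrease weakly on the first [k]
   indices. *)
suff H k : (k <= n)%N -> \sum_f F f = \sum_(f | chain_upto k f) F f by exact: H.
elim: k => [|k IHk] lt_kn.
  by apply: eq_bigl => f; apply/esym/forallP => i; rewrite ltn0.
rewrite {}IHk ?(ltnW lt_kn) // (bigID (chain_upto k.+1)) /= [X in _ + X](_ : _ = 0) ?addr0.
  apply: eq_bigl => f; rewrite andb_idl // => /forallP ch; apply/forallP => i.
  by apply/implyP => lt_ik; apply: (implyP (ch i)); apply: ltnW.
pose o := Ordinal lt_kn.
case: k => [|k] in lt_kn o *.
  by apply: big1 => f /andP[_ /forallPn[i]].
have lt_kn' := ltnW lt_kn.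
under eq_bigl => f.
  have -> : chain_upto k.+1 f && ~~ chain_upto k.+2 f =
            chain_upto k.+1 f && (fn f k < fn f k.+1)%N.
    case: (boolP (chain_upto k.+1 f)) => //= /forallP ch; apply/idP/idP.
      case/forallPn => i; rewrite negb_imply -ltnNge => /andP[lt_ik lt_f].
      have := ch i; rewrite [X in _ ==> X]leqNgt lt_f implybF -leqNgt ltnS => le_ki.
      by have -> : k = i :> nat by lia.
    move=> lt_f; apply/forallPn; exists (Ordinal lt_kn').
    by rewrite negb_imply ltnSn -ltnNge.
  over.
(* Each [f] is encoded as [f] with its value at [k.+1] reset to 0, paired with that value, which can
   then be summed first. *)
rewrite (reindex_onto (fun gq => upd gq.1 o gq.2) (fun f => (upd f o ord0, f o))) /=; last first.
  by move=> f _; apply/ffunP => j; rewrite !ffunE; case: eqP => [->|].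
transitivity (\sum_(g | chain_upto k.+1 g && (g o == ord0)) \sum_(q < Q.+1 | (fn g k < q)%N) F (upd g o q)).
  rewrite pair_big_dep; apply: eq_bigl => -[g q] /=.
  rewrite !fn_upd eqxx -[k == _]/(k == k.+1) (ltn_eqF (ltnSn k)).
  have -> : chain_upto k.+1 (upd g o q) = chain_upto k.+1 g.
    apply: eq_forallb => i; rewrite !fn_upd /=; case: ltnP => //= lt_ik.
    by rewrite !ltn_eqF // ltnW.
  rewrite andbAC; congr (_ && _ && _); rewrite xpair_eqE ffunE !eqxx andbT.
  apply/eqP/eqP => [<-|g0]; first by rewrite ffunE eqxx.
  by apply/ffunP => j; rewrite !ffunE; case: eqP => [->|].
apply: big1 => g _.
pose p := Ordinal lt_kn'.
have neq_po : p != o by rewrite -val_eqE /= ltn_eqF.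
have fnk : fn g k = g p by rewrite -fnE.
case: (ltnP (g p) (nu k)) => [lt_nu|le_nu].
  apply: big1 => q _; rewrite /F (bigD1 p) //= ffunE (negPf neq_po) W0 //.
  by rewrite !mul0r.
have [kap tailE] := tail k (g p) lt_kn le_nu.
pose M (u : 'I_n -> R) := \matrix_(i < n, j < n) (if j == o then u i else c j (g j) i).
transitivity (\prod_(j < n | j != o) W j (g j) *
  \det (M (fun i => \sum_(q < Q.+1 | (fn g k < q)%N) W k.+1 q * c k.+1 q i))).
  have expE u : \det (M u) = \sum_i u i * cofactor (M (fun=> 0)) i o.
    rewrite (expand_det_col _ o); apply: eq_bigr => i _; rewrite mxE eqxx.
    congr (_ * (_ * \det _)); apply/matrixP => i' j'; rewrite !mxE.
    by rewrite eq_sym (negPf (neq_lift _ _)).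
  rewrite expE mulr_sumr; under [RHS]eq_bigr => i _ do rewrite mulr_suml mulr_sumr.
  rewrite exchange_big; apply: eq_bigr => q _ /=.
  rewrite /F (bigD1 o) //= ffunE eqxx.
  have -> : \prod_(j < n | j != o) W j (upd g o q j) = \prod_(j < n | j != o) W j (g j).
    by apply: eq_bigr => j /negPf neq_j; rewrite ffunE neq_j.
  have -> : \matrix_(i < n, j < n) c j (upd g o q j) i = M (c k.+1 q).
    by apply/matrixP => i j; rewrite !mxE ffunE; case: eqP => [->|].
  rewrite expE mulr_sumr; apply: eq_bigr => i _.
  by rewrite /=; ring.
have -> : M (fun i => \sum_(q < Q.+1 | (fn g k < q)%N) W k.+1 q * c k.+1 q i)
    = M (fun i => kap * c k (g p) i).
  by apply/matrixP => i j; rewrite !mxE; case: eqP => // _; rewrite fnk tailE.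
(* The factor [kap] comes out of column [o], leaving a matrix whose columns [p] and [o] coincide. *)
rewrite -det_tr (@determinant_multilinear _ _ _ (M (c k (g p)))^T (M (c k (g p)))^T o kap 0).
- rewrite mul0r addr0 (@determinant_alternate _ _ _ p o) ?mulr0 // => i.
  by rewrite !mxE eqxx (negPf neq_po).
- by apply/rowP => i; rewrite !mxE eqxx mul0r addr0.
- by apply/matrixP => i j; rewrite !mxE eq_sym (negPf (neq_lift _ _)).
- by apply/matrixP => i j; rewrite !mxE eq_sym (negPf (neq_lift _ _)).
Qed.
End MultilinearExpansion.

(** * Peeling the smallest value off a filling *)

Lemma decn_le (f : nat -> nat) : (forall i, f i.+1 <= f i)%N ->
  forall i j, (i <= j)%N -> (f j <= f i)%N.
Proof.
move=> f_dec i j /subnK <-; elim: (j - i)%N => // k IHk.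
exact: leq_trans (f_dec _) IHk.
Qed.

Lemma fn_dec n Q (f : {ffun 'I_n -> 'I_Q.+1}) : chain_upto n f ->
  forall i, (fn f i.+1 <= fn f i)%N.
Proof.
move=> /forallP ch i; have [lt_in|le_ni] := ltnP i.+1 n; last by rewrite fn_out.
exact: (implyP (ch (Ordinal (ltnW lt_in)))).
Qed.

Lemma ltn_bigmax (I : finType) (P : pred I) (F : I -> nat) k :
  (k < \max_(i | P i) F i)%N -> exists2 i, P i & (k < F i)%N.
Proof.
move=> lt_k; have [/existsP[i /andP[Pi lt_kF]]|] := boolP [exists i, P i && (k < F i)%N].
  by exists i.
rewrite negb_exists => /forallP no.
have/bigmax_leqP: forall i, P i -> (F i <= k)%N.
  by move=> i Pi; move: (no i); rewrite Pi /= -leqNgt.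
by rewrite leqNgt lt_k.
Qed.

Lemma big_nat_ord (R : Type) (idx : R) (op : Monoid.law idx) (F : nat -> R) p q Q :
  (q <= Q)%N ->
  \big[op/idx]_(p <= l < q) F l = \big[op/idx]_(l < Q | (p <= l < q)%N) F l.
Proof.
move=> le_qQ; rewrite (big_nat_widenl _ _ _ _ _ (leq0n p)) (big_nat_widen _ _ _ _ _ le_qQ).
by rewrite big_mkord.
Qed.

(* The weight of the run of [v]s occupying columns [nu j <= l < q] of row [j],
   the row above ending at column [nu j.-1]. *)
Definition strip_weight (R : comNzRingType) (y z a b : nat -> R) (nu : nat -> nat) v j q : R :=
  \prod_(nu j <= l < q) ((if (0 < j)%N && (nu j.-1 <= l)%N then b j else y v)
                         + (if (l.+1 < q)%N then - a l.+1 else z v)).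

Section Fillings.
Variables (C : finType) (ri cj : C -> nat) (N : nat).
Implicit Types (T : {ffun C -> 'I_N.+1}) (c d : C).

(** Cells form an abstract finite type with coordinates [ri] and [cj], so that the rotated shape of
    the column formula is covered as well. *)
Definition cell_le c d :=
  (ri c == ri d) && (cj c <= cj d)%N || (cj c == cj d) && (ri c <= ri d)%N.

Definition monotone T := [forall c, forall d, cell_le c d ==> (T c <= T d)%N].

Definition eq_up T c := [exists d, [&& ri c == (ri d).+1, cj d == cj c & T d == T c]].

Definition eq_next T c := [exists d, [&& ri d == ri c, cj d == (cj c).+1 & T d == T c]].

Variables (R : comNzRingType) (y z a b : nat -> R).

Definition super_wt T c : R :=
  (if eq_up T c then b (ri c) else y (T c))
  + (if eq_next T c then - a (cj c).+1 else z (T c)).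

Variables r s : nat -> nat.

Definition in_flags T := [forall c, (r (ri c) <= T c <= s (ri c))%N].

Definition super_g : R := \sum_(T | monotone T && in_flags T) \prod_c super_wt T c.

(* Cells of the partition [nu] are frozen at the value [0]; the others have values
   at least [v]. *)
Definition frozen (nu : nat -> nat) v T :=
  monotone T && [forall c, if (cj c < nu (ri c))%N then (T c == 0 :> nat)
                           else (maxn v (r (ri c)) <= T c <= s (ri c))%N].

Definition frozen_g nu v : R :=
  \sum_(T | frozen nu v T) \prod_(c | (nu (ri c) <= cj c)%N) super_wt T c.

Variables (n Q : nat) (lam mu : nat -> nat).
Hypothesis cell_inj : forall c d, ri c = ri d -> cj c = cj d -> c = d.
Hypothesis cell_row : forall c, (ri c < n)%N.
Hypothesis cell_col : forall c, (mu (ri c) <= cj c < lam (ri c))%N.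
Hypothesis cell_ex : forall i j, (i < n)%N -> (mu i <= j < lam i)%N ->
  exists c, ri c = i /\ cj c = j.
Hypothesis lam_dec : forall i, (lam i.+1 <= lam i)%N.
Hypothesis lam_Q : forall i, (i < n)%N -> (lam i <= Q)%N.

(** [f] records where the run of [v]s ends in each row; a nonempty run requires that the flags of
    the row admit [v]. *)
Definition extends (nu : nat -> nat) v (f : {ffun 'I_n -> 'I_Q.+1}) :=
  chain_upto n f && [forall i : 'I_n, (nu i <= f i <= lam i)%N
                                      && ((f i != nu i :> nat) ==> (r i <= v <= s i)%N)].

Section Peel.
Variables (nu : nat -> nat) (v : nat).
Hypothesis nu_dec : forall i, (nu i.+1 <= nu i)%N.
Hypothesis mu_nu : forall i, (i < n)%N -> (mu i <= nu i)%N.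
Hypothesis nu_lam : forall i, (i < n)%N -> (nu i <= lam i)%N.
Hypothesis v_gt0 : (0 < v)%N.
Hypothesis v_N : (v <= N)%N.

Let strip_end T (i : nat) :=
  maxn (nu i) (\max_(c | (ri c == i) && (T c == v :> nat)) (cj c).+1).
Let peel T : {ffun 'I_n -> 'I_Q.+1} * {ffun C -> 'I_N.+1} :=
  ([ffun i : 'I_n => inord (strip_end T i)],
   [ffun c => if T c == v :> nat then ord0 else T c]).
Let glue (p : {ffun 'I_n -> 'I_Q.+1} * {ffun C -> 'I_N.+1}) : {ffun C -> 'I_N.+1} :=
  [ffun c => if (nu (ri c) <= cj c < fn p.1 (ri c))%N then inord v else p.2 c].

Let strip_end_lam T i : (i < n)%N -> (strip_end T i <= lam i)%N.
Proof.
move=> lt_in; rewrite geq_max nu_lam //; apply/bigmax_leqP => c /andP[/eqP<- _].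
by have /andP[] := cell_col c.
Qed.

Let fn_peel T i : (i < n)%N -> fn (peel T).1 i = strip_end T i.
Proof.
move=> lt_in; rewrite (fnE _ (Ordinal lt_in)) ffunE inordK //= ltnS.
exact: leq_trans (strip_end_lam _ _) (lam_Q _).
Qed.

Let frozenP T c : frozen nu v T ->
  if (cj c < nu (ri c))%N then T c = 0 :> nat
  else (v <= T c)%N /\ (r (ri c) <= T c <= s (ri c))%N.
Proof.
move=> /andP[_ /forallP/(_ c)]; case: ifP => [_ /eqP//|_].
by rewrite geq_max => /andP[/andP[-> ->] ->].
Qed.

(** Unfrozen values are at least [v], so an unfrozen cell to the left of a [v] in its row is itself
    a [v]. *)
Let mem_strip T c : frozen nu v T ->
  (cj c < strip_end T (ri c))%N = (cj c < nu (ri c))%N || (T c == v :> nat).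
Proof.
move=> frT; rewrite leq_max; case: ltnP => //= le_nu.
apply/idP/eqP => [lt_c|Tc]; last first.
  by apply: (leq_bigmax_cond (F := fun c => (cj c).+1)); rewrite eqxx Tc eqxx.
have [d /andP[/eqP ri_d /eqP Td]] := ltn_bigmax lt_c; rewrite ltnS => le_cd.
have := frozenP c frT; rewrite ltnNge le_nu /= => -[le_vc _].
apply/eqP; rewrite eqn_leq le_vc andbT -Td.
have /andP[/forallP/(_ c)/forallP/(_ d)/implyP + _] := frT; apply.
by rewrite /cell_le ri_d eqxx le_cd.
Qed.

(** If a run passed the end of the row above, the cell above an overhanging [v] would be an unfrozen
    cell of the shape with value at most [v], hence equal to [v], although it lies beyond the end of
    its row's run. *)
Let peel_chain T : frozen nu v T -> chain_upto n (peel T).1.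
Proof.
move=> frT; apply/forallP => i; apply/implyP => lt_in.
rewrite !fn_peel // leqNgt; apply/negP => lt_end.
have le_nu : (nu i <= strip_end T i)%N by apply: leq_maxl.
move: (lt_end); rewrite {2}/strip_end leq_max => /orP[lt_nu|].
  by have := leq_trans lt_nu (nu_dec i); rewrite ltnNge le_nu.
case/ltn_bigmax => d /andP[/eqP ri_d /eqP Td]; rewrite ltnS => le_d.
have /andP[_ lt_dlam] := cell_col d.
have [c [ri_c cj_c]] : exists c, ri c = i /\ cj c = cj d.
  apply: cell_ex => //; rewrite (leq_trans (mu_nu _) (leq_trans le_nu le_d)) //=.
  by apply: leq_trans lt_dlam _; rewrite ri_d lam_dec.
have Tc : (T c <= v)%N.
  have /andP[/forallP/(_ c)/forallP/(_ d)/implyP + _] := frT; rewrite -Td; apply.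
  by rewrite /cell_le cj_c eqxx ri_c ri_d leqnSn orbT.
have := mem_strip c frT; rewrite ri_c cj_c [X in X = _]ltnNge le_d /= => /esym/norP[le_nu' neq_v].
have := frozenP c frT; rewrite ri_c cj_c (negPf le_nu') => -[le_v _].
by case/negP: neq_v; rewrite eqn_leq Tc le_v.
Qed.

Let peelP T : frozen nu v T ->
  [/\ extends nu v (peel T).1, frozen (fn (peel T).1) v.+1 (peel T).2 & glue (peel T) = T].
Proof.
move=> frT; have mem c : (cj c < fn (peel T).1 (ri c))%N = (cj c < nu (ri c))%N || (T c == v :> nat).
  by rewrite fn_peel // mem_strip.
split.
- rewrite /extends peel_chain //=; apply/forallP => i.
  rewrite -fnE fn_peel // leq_maxl strip_end_lam //=; apply/implyP => neq.
  have : (nu i < strip_end T i)%N by rewrite ltn_neqAle eq_sym neq leq_maxl.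
  rewrite leq_max ltnn /= => /ltn_bigmax[c /andP[/eqP<- /eqP Tc] _].
  have := frozenP c frT; case: ifP => [_|_ [_]]; last by rewrite Tc.
  by rewrite Tc => v0; move: v_gt0; rewrite v0.
- apply/andP; split.
    apply/forallP => c; apply/forallP => d; apply/implyP => le_cd.
    have /andP[/forallP/(_ c)/forallP/(_ d)/implyP/(_ le_cd) le_T _] := frT.
    rewrite !ffunE; have := frozenP c frT.
    by do 2 case: eqP; case: ifP => //=; lia.
  apply/forallP => c; rewrite mem ffunE; have := frozenP c frT.
  case: ltnP => /= [_ T0|_ [le_v /andP[le_r le_s]]].
    by rewrite T0 (ltn_eqF v_gt0) T0.
  by case: eqP => //= neq; rewrite geq_max le_r le_s; lia.
apply/ffunP => c; rewrite !ffunE mem; have := frozenP c frT.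
case: ltnP => /= [_ T0|_ _].
  by rewrite T0 (ltn_eqF v_gt0).
by case: eqP => //= Tc; apply: val_inj; rewrite /= inordK // Tc.
Qed.

Let nu_row c d : cell_le c d -> (cj d < nu (ri d))%N -> (cj c < nu (ri c))%N.
Proof.
case/orP => /andP[/eqP-> le_cd] //; first by move/(leq_ltn_trans le_cd) => ->.
by move=> lt_d; apply: leq_trans lt_d (decn_le nu_dec le_cd).
Qed.

Section Glue.
Variables (f : {ffun 'I_n -> 'I_Q.+1}) (T : {ffun C -> 'I_N.+1}).
Hypothesis ext_f : extends nu v f.
Hypothesis fr_T : frozen (fn f) v.+1 T.

Let f_bounds i : (i < n)%N -> (nu i <= fn f i <= lam i)%N.
Proof.
move=> lt_in; have /andP[_ /forallP/(_ (Ordinal lt_in))/andP[]] := ext_f.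
by rewrite -fnE.
Qed.

Let f_chain i : (fn f i.+1 <= fn f i)%N.
Proof. by apply: fn_dec; case/andP: ext_f. Qed.

Let nu_f c : (cj c < nu (ri c))%N -> (cj c < fn f (ri c))%N.
Proof. by move=> lt; have /andP[le _] := f_bounds (cell_row c); apply: leq_trans lt le. Qed.

Let T_frozen c : if (cj c < fn f (ri c))%N then T c = 0 :> nat
  else (v < T c)%N /\ (r (ri c) <= T c <= s (ri c))%N.
Proof.
have /andP[_ /forallP/(_ c)] := fr_T; case: ifP => [_ /eqP//|_].
by rewrite geq_max => /andP[/andP[-> ->] ->].
Qed.

Let glueE c : glue (f, T) c = (if (nu (ri c) <= cj c < fn f (ri c))%N then v else T c) :> nat.
Proof. by rewrite ffunE /=; case: ifP => // _; rewrite inordK. Qed.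

Let glue_v c : (glue (f, T) c == v :> nat) = (nu (ri c) <= cj c < fn f (ri c))%N.
Proof.
rewrite glueE; case: ifP => [_|]; first by rewrite eqxx.
have := T_frozen c; case: ltnP => [lt_f -> _|_ [lt_v _] _]; last by rewrite gtn_eqF.
by rewrite ltn_eqF.
Qed.

Let glue_frozen : frozen nu v (glue (f, T)).
Proof.
apply/andP; split.
  apply/forallP => c; apply/forallP => d; apply/implyP => le_cd; rewrite !glueE.
  have := T_frozen c; have := T_frozen d.
  have f_row : (cj d < fn f (ri d))%N -> (cj c < fn f (ri c))%N.
    case/orP: le_cd => /andP[/eqP-> le_cd]; first by move/(leq_ltn_trans le_cd) => ->.
    by move=> lt_d; apply: leq_trans lt_d (decn_le f_chain le_cd).
  have /andP[/forallP/(_ c)/forallP/(_ d)/implyP/(_ le_cd) le_T _] := fr_T.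
  have := nu_row le_cd; have := @nu_f d; have := @nu_f c.
  case: (ltnP (cj c) (nu (ri c))); case: (ltnP (cj d) (nu (ri d)));
    case: (ltnP (cj c) (fn f (ri c))); case: (ltnP (cj d) (fn f (ri d))) => /=; lia.
apply/forallP => c; rewrite glueE; have := T_frozen c.
have [lt_nu|le_nu] /= := ltnP (cj c) (nu (ri c)); first by rewrite nu_f // => ->.
case: ifP => [lt_f _|_ [lt_v /andP[le_r ->]]]; last by rewrite geq_max (ltnW lt_v) le_r.
have /andP[_ /forallP/(_ (Ordinal (cell_row c)))/andP[_ /implyP]] := ext_f.
rewrite -fnE /= geq_max leqnn /=; apply.
by rewrite gtn_eqF // (leq_ltn_trans le_nu lt_f).
Qed.

Let glueK : peel (glue (f, T)) = (f, T).
Proof.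
congr pair; apply/ffunP; last first.
  move=> c.
  rewrite [LHS]ffunE glue_v; apply: val_inj.
  have [/andP[_ lt_f]|/negPf c_out] := boolP (nu (ri c) <= cj c < fn f (ri c))%N.
    by have := T_frozen c; rewrite lt_f => /= ->.
  by rewrite /= glueE c_out.
move=> i; apply: ord_inj; rewrite -(fnE (peel (glue (f, T))).1) -fnE fn_peel //.
have /andP[le_nu le_lam] := f_bounds (ltn_ord i).
apply/eqP; rewrite eqn_leq geq_max le_nu; apply/andP; split.
  by apply/bigmax_leqP => c /andP[/eqP<-]; rewrite glue_v => /andP[].
rewrite leq_max; have [//|lt_f] /= := leqP (fn f i) (nu i).
have [c [ri_c cj_c]] : exists c, ri c = i /\ cj c = (fn f i).-1.
  by apply: cell_ex => //; have := mu_nu (ltn_ord i); lia.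
rewrite -(prednK (leq_ltn_trans (leq0n _) lt_f)) -cj_c.
apply: (leq_bigmax_cond (F := fun c => (cj c).+1)).
by rewrite glue_v ri_c cj_c eqxx; lia.
Qed.

(** A cell beyond [f] has value above [v], whereas cells inside [f] have value 0 before and 0 or [v]
    after gluing, so gluing creates no equality with it. *)
Let glue_T c d : (fn f (ri c) <= cj c)%N -> (glue (f, T) d == glue (f, T) c) = (T d == T c).
Proof.
move=> le_f; have lt_v : (v < T c)%N by have := T_frozen c; rewrite ltnNge le_f => -[].
rewrite -!val_eqE /= (glueE c) [(cj c < _)%N]ltnNge le_f andbF (glueE d).
case: ifP => // /andP[_ lt_f]; have := T_frozen d; rewrite lt_f => ->.
by rewrite !ltn_eqF //; lia.
Qed.

Let super_wt_outer c : (fn f (ri c) <= cj c)%N ->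
  super_wt (glue (f, T)) c = super_wt T c.
Proof.
move=> le_f; have glue_c : glue (f, T) c = T c.
  by apply: val_inj; rewrite /= glueE [(_ < fn f _)%N]ltnNge le_f andbF.
rewrite /super_wt glue_c.
have -> : eq_up (glue (f, T)) c = eq_up T c.
  by apply: eq_existsb => d; rewrite glue_T.
have -> // : eq_next (glue (f, T)) c = eq_next T c.
by apply: eq_existsb => d; rewrite glue_T.
Qed.

Let glue_eq c d : (nu (ri c) <= cj c < fn f (ri c))%N ->
  (glue (f, T) d == glue (f, T) c) = (nu (ri d) <= cj d < fn f (ri d))%N.
Proof. by move=> c_in; rewrite -glue_v -val_eqE /= (glueE c) c_in. Qed.

Let super_wt_strip c : (nu (ri c) <= cj c < fn f (ri c))%N ->
  super_wt (glue (f, T)) c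
  = (if (0 < ri c)%N && (nu (ri c).-1 <= cj c)%N then b (ri c) else y v)
    + (if ((cj c).+1 < fn f (ri c))%N then - a (cj c).+1 else z v).
Proof.
move=> c_in; have glue_c : glue (f, T) c = v :> nat by rewrite glueE c_in.
rewrite /super_wt glue_c.
(* As [f] decreases, the cell above lies before the end of its own row's run; it has value [v]
   exactly when it is outside [nu]. *)
have -> : eq_up (glue (f, T)) c = (0 < ri c)%N && (nu (ri c).-1 <= cj c)%N.
  apply/existsP/andP => [[d /and3P[/eqP ri_c /eqP cj_d]]|[ri_gt0 le_nu]].
    by rewrite glue_eq // ri_c cj_d => /andP[->].
  have lt_in : ((ri c).-1 < n)%N by have := cell_row c; lia.
  have le_f : (fn f (ri c) <= fn f (ri c).-1)%N by rewrite -{1}(prednK ri_gt0).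
  have /andP[_ le_lam] := f_bounds lt_in; have le_mu := mu_nu lt_in.
  have [d [ri_d cj_d]] : exists d, ri d = (ri c).-1 /\ cj d = cj c.
    by apply: cell_ex => //; lia.
  by exists d; rewrite glue_eq // ri_d cj_d prednK // !eqxx /=; lia.
have -> // : eq_next (glue (f, T)) c = ((cj c).+1 < fn f (ri c))%N.
apply/existsP/idP => [[d /and3P[/eqP ri_d /eqP cj_d]]|lt_f].
  by rewrite glue_eq // ri_d cj_d => /andP[].
have /andP[_ le_lam] := f_bounds (cell_row c); have /andP[le_mu _] := cell_col c.
have [d [ri_d cj_d]] : exists d, ri d = ri c /\ cj d = (cj c).+1.
  by apply: cell_ex => //; lia.
by exists d; rewrite glue_eq // ri_d cj_d !eqxx /=; lia.
Qed.

Let strip_prod :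
  \prod_(c | (nu (ri c) <= cj c < fn f (ri c))%N) super_wt (glue (f, T)) c
  = \prod_(j < n) strip_weight y z a b nu v j (f j).
Proof.
pose F (j l : nat) := (if (0 < j)%N && (nu j.-1 <= l)%N then b j else y v)
    + (if (l.+1 < fn f j)%N then - a l.+1 else z v).
rewrite (eq_bigr (fun c => F (ri c) (cj c))) => [|c c_in]; last by rewrite super_wt_strip.
pose key c : 'I_n * 'I_Q.+1 := (Ordinal (cell_row c), inord (cj c)).
rewrite (partition_big key xpredT) //= -(pair_bigA _ (fun j l =>
  \prod_(c | (nu (ri c) <= cj c < fn f (ri c))%N && (key c == (j, l))) F (ri c) (cj c))) /=.
have cj_Q c : (cj c < Q.+1)%N.
  by have := lam_Q (cell_row c); have /andP[_] := cell_col c; lia.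
apply: eq_bigr => j _; rewrite /strip_weight (big_nat_ord _ _ _ (ltnW (ltn_ord (f j)))).
rewrite [RHS]big_mkcond; apply: eq_bigr => l _.
have [l_in|l_out] := boolP (nu j <= l < f j)%N; last first.
  apply: big_pred0 => c; apply/negP => /andP[c_in /eqP[ri_c cj_c]].
  case/negP: l_out; rewrite -fnE -ri_c -cj_c /= inordK //.
have := f_bounds (ltn_ord j); rewrite fnE => /andP[_ le_lam].
have le_mu := mu_nu (ltn_ord j).
have [c [ri_c cj_c]] : exists c, ri c = j /\ cj c = l by apply: cell_ex => //; lia.
rewrite (big_pred1 c) => [|d] /=; first by rewrite /F ri_c cj_c fnE.
apply/andP/eqP => [[_ /eqP[ri_d cj_d]]|->].
  apply: cell_inj; first by rewrite ri_c -ri_d.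
  by rewrite cj_c -cj_d inordK.
rewrite ri_c cj_c fnE; split=> //; apply/eqP; congr pair; apply: val_inj => //=.
by rewrite cj_c inordK.
Qed.

Lemma glueP : [/\ frozen nu v (glue (f, T)), peel (glue (f, T)) = (f, T) &
  \prod_(c | (nu (ri c) <= cj c)%N) super_wt (glue (f, T)) c
  = \prod_(j < n) strip_weight y z a b nu v j (f j)
    * \prod_(c | (fn f (ri c) <= cj c)%N) super_wt T c].
Proof.
split=> //; rewrite (bigID (fun c => cj c < fn f (ri c))%N) /= strip_prod.
congr (_ * _); apply: eq_big => c.
  rewrite -leqNgt andb_idl // => le_f; apply: leq_trans le_f.
  by have /andP[] := f_bounds (cell_row c).
by rewrite -leqNgt => /andP[_ le_f]; apply: super_wt_outer.
Qed.
End Glue.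

Lemma frozen_g_step :
  frozen_g nu v = \sum_(f | extends nu v f)
    \prod_(j < n) strip_weight y z a b nu v j (f j) * frozen_g (fn f) v.+1.
Proof.
rewrite /frozen_g (reindex_onto glue peel) => [|T frT]; last by case: (peelP frT).
under [RHS]eq_bigr => f _ do rewrite mulr_sumr.
rewrite pair_big_dep; apply: eq_big => [[f T]|[f T]] /=.
  apply/andP/andP => [[frT /eqP eqT]|[ext_f frT]].
    by have [] := peelP frT; rewrite eqT.
  by have [-> -> _] := glueP ext_f frT.
case/andP=> frT /eqP eqT; have [ext_f frf _] := peelP frT.
by rewrite eqT in ext_f frf; have [_ _ ->] := glueP ext_f frf.
Qed.
End Peel.
End Fillings.

(** * Peeling the smallest value off the determinant *)

Section Run.
Variables (R : comNzRingType) (a : nat -> R).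

Definition run_weight (y z bt : R) (m p q : nat) : R :=
  \prod_(p <= l < q) ((if (m <= l)%N then bt else y)
                      + (if (l.+1 < q)%N then - a l.+1 else z)).

Lemma run_weightS y z bt m p l : (p <= l)%N ->
  run_weight y z bt m p l.+1
  = (\prod_(p <= t < l) ((if (m <= t)%N then bt else y) - a t.+1))
    * ((if (m <= l)%N then bt else y) + z).
Proof.
move=> le_pl; rewrite /run_weight big_nat_recr //= ltnn; congr (_ * _).
by apply: eq_big_nat => t /andP[_ lt_tl]; rewrite ltnS lt_tl.
Qed.

(** Meant for [c] a matrix entry and [d] its companion [entry_step], as functions of the inner
    part. *)
Lemma telescope (u : R) (c d : nat -> R) p m :
  (forall q, d q = c q.+1 + (u - a q.+1) * d q.+1) -> (p <= m)%N ->
  d p = \sum_(p <= l < m) (\prod_(p <= t < l) (u - a t.+1)) * c l.+1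
        + (\prod_(p <= t < m) (u - a t.+1)) * d m.
Proof.
move=> dE; elim: m => [|m IHm] le_pm.
  by move: le_pm; rewrite leqn0 => /eqP->; rewrite !big_geq // add0r mul1r.
case: (ltngtP p m.+1) le_pm => // [lt_pm _|-> _]; last first.
  by rewrite !big_geq // add0r mul1r.
rewrite IHm // big_nat_recr //= [\prod_(p <= t < m.+1) _]big_nat_recr //= [d m]dE.
by ring.
Qed.

(** Runs ending beyond the row above have [bt] in all factors from [m] on, so their sum is the
    telescoping expansion of [d m']; the remainder vanishes at [Q]. *)
Lemma run_tail y z bt (c d : nat -> R) m p m' Q :
  (forall q, d q = c q.+1 + (bt - a q.+1) * d q.+1) -> d Q = 0 ->
  (p <= m <= m')%N -> (m' <= Q)%N ->
  \sum_(m'.+1 <= q < Q.+1) run_weight y z bt m p q * c q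
  = (\prod_(p <= t < m') ((if (m <= t)%N then bt else y) - a t.+1)) * (bt + z) * d m'.
Proof.
move=> dE dQ /andP[le_pm le_mm'] le_mQ; rewrite [d m'](telescope dE le_mQ) dQ mulr0 addr0.
rewrite big_add1 /= mulr_sumr; apply: eq_big_nat => l /andP[le_ml _].
rewrite run_weightS; last by lia.
rewrite (leq_trans le_mm' le_ml) (big_cat_nat _ (n := m')) //=; last by lia.
have -> : \prod_(m' <= t < l) ((if (m <= t)%N then bt else y) - a t.+1)
    = \prod_(m' <= t < l) (bt - a t.+1).
  by apply: eq_big_nat => t /andP[le_t _]; rewrite (leq_trans le_mm' le_t).
by ring.
Qed.

(** Runs ending by column [m] telescope with [y] and give [e]; longer ones are summed by [run_tail]
    and give [d]. *)
Lemma run_sum y z bt (c e d : nat -> R) m p Q :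
  (forall q, e q = c q.+1 + (y - a q.+1) * e q.+1) ->
  (forall q, d q = c q.+1 + (bt - a q.+1) * d q.+1) -> d Q = 0 ->
  (p <= m <= Q)%N ->
  \sum_(p <= q < Q.+1) run_weight y z bt m p q * c q
  = c p + (y + z) * e p
    - (\prod_(p <= t < m) (y - a t.+1)) * ((y + z) * e m - (bt + z) * d m).
Proof.
move=> eE dE dQ /andP[le_pm le_mQ].
rewrite (big_cat_nat _ (n := m.+1)) //=; last by lia.
rewrite (run_tail _ _ dE) // ?le_pm ?leqnn // big_ltn //.
rewrite {1}/run_weight big_geq // mul1r big_add1 /= (telescope eE le_pm).
have -> : \sum_(p <= l < m) run_weight y z bt m p l.+1 * c l.+1
    = (y + z) * \sum_(p <= l < m) (\prod_(p <= t < l) (y - a t.+1)) * c l.+1.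
  rewrite mulr_sumr; apply: eq_big_nat => l /andP[le_pl lt_lm].
  rewrite run_weightS // leqNgt lt_lm /=.
  rewrite (eq_big_nat _ _ (F2 := fun t => y - a t.+1)) => [|t /andP[_ lt_tl]]; first by ring.
  by rewrite leqNgt (ltn_trans lt_tl lt_lm).
have -> : \prod_(p <= t < m) ((if (m <= t)%N then bt else y) - a t.+1)
   = \prod_(p <= t < m) (y - a t.+1).
  by apply: eq_big_nat => t /andP[_ lt_tm]; rewrite leqNgt lt_tm.
by ring.
Qed.
End Run.

(** * Flagged determinants over an abstract plethystic family *)

Section Plethystic.
Variables (R : comNzRingType) (V : zmodType) (H : int -> V -> R) (io : R -> V).
Hypothesis H_addU : forall m Z u, H m Z = H m (Z + io u) - u * H (m - 1) (Z + io u).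
Hypothesis H_dom0 : forall m, H m 0 = (m == 0)%:R.
Hypothesis H_lt0 : forall m Z, (m < 0) -> H m Z = 0.
Hypothesis H_0 : forall Z, H 0 Z = 1.
Variables (L : nat -> V) (y z a b : nat -> R).
Hypothesis H_letter : forall k m Z,
  H m (Z + L k) = H m (Z + io (y k)) + z k * H (m - 1) (Z + io (y k)).

(** [H] stands for [h] with [io u = << u >>], or for [e] with [io u = - << - u >>]; in both cases
    adding [io u] divides the generating series by [1 - u t]. *)
Definition fsum (f : nat -> R) k : V := \sum_(1 <= l < k.+1) io (f l).

Lemma fsumS f k : fsum f k.+1 = fsum f k + io (f k.+1).
Proof. by rewrite /fsum big_nat_recr. Qed.

(** The lower flag and the inner part are arguments separate from the column index, because peeling
    changes them within a fixed column. *)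
Definition entry (lam : nat -> nat) s rj j q i : R :=
  H ((lam i)%:Z - q%:Z - i%:Z + j%:Z)
    (\sum_(rj <= k < (s i).+1) L k - fsum a (lam i).-1 + fsum a q + fsum b i - fsum b j).

(** Coefficient form of [1/(1 - u t) = 1/(1 - w t) + (u - w) t/((1 - u t)(1 - w t))]. *)
Lemma H_exchange m Z u w :
  H m (Z + io u) = H m (Z + io w) + (u - w) * H (m - 1) (Z + io w + io u).
Proof. by rewrite (H_addU m (Z + io u) w) (H_addU m (Z + io w) u) addrAC; ring. Qed.

(** The generating series is the product of the [1 - u t], a polynomial of degree at most
    [size l]. *)
Lemma H_negsum (l : seq R) m : (size l)%:Z < m -> H m (- \sum_(u <- l) io u) = 0.
Proof.
elim: l m => [|u l IHl] m /= lt_m.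
  by rewrite big_nil oppr0 H_dom0 gt_eqF.
rewrite big_cons (H_addU _ _ u) opprD addrAC addNr add0r !IHl ?mulr0 ?subr0 //; lia.
Qed.

Lemma fsum_diff f k l : (k <= l)%N ->
  fsum f l - fsum f k = \sum_(u <- [seq f t | t <- index_iota k.+1 l.+1]) io u.
Proof.
move=> le_kl; rewrite big_map /fsum (big_cat_nat _ (n := k.+1)) //=.
by rewrite addrAC subrr add0r.
Qed.

Section Entries.
Variables (lam s : nat -> nat).

Lemma entry_neg rj j q i : (lam i + j < q + i)%N -> entry lam s rj j q i = 0.
Proof. by move=> lt; apply: H_lt0; lia. Qed.

Lemma entry_diag rj i : entry lam s rj i (lam i) i = 1.
Proof.
rewrite /entry; set Z := (X in H _ X).
by rewrite (_ : _ + _ = 0) ?H_0 //; lia.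
Qed.

(** Without letters the argument is minus a sum of [lam i - 1 - q + j - i] parameters, one fewer
    than the degree. *)
Lemma entry_empty rj j q i :
  (i <= j)%N -> (q < lam i)%N -> (s i < rj)%N -> entry lam s rj j q i = 0.
Proof.
move=> le_ij lt_q lt_s; rewrite /entry big_geq // sub0r.
set l := [seq a t | t <- index_iota q.+1 (lam i).-1.+1]
         ++ [seq b t | t <- index_iota i.+1 j.+1].
rewrite (_ : - _ + _ + _ - _ = - \sum_(u <- l) io u).
  by apply: H_negsum; rewrite size_cat !size_map !size_iota; lia.
rewrite big_cat /= -!fsum_diff //; last by lia.
by rewrite opprD !opprB !addrA [- _ + fsum a q]addrC.
Qed.

(** Lowering the degree and adding a letter [u] gives the auxiliary sequence in [q] that telescopes
    over the ends of a run. *)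
Definition entry_step u rj j q i : R :=
  H ((lam i)%:Z - q%:Z - i%:Z + j%:Z - 1)
    (\sum_(rj <= k < (s i).+1) L k - fsum a (lam i).-1 + fsum a q + fsum b i - fsum b j
     + io u).

(** This exchanges [u] with [a q.+1], the letter whose addition raises [q] to [q.+1] in the
    entry. *)
Lemma entry_stepE u rj j q i :
  entry_step u rj j q i
  = entry lam s rj j q.+1 i + (u - a q.+1) * entry_step u rj j q.+1 i.
Proof.
rewrite /entry_step (H_exchange _ _ u (a q.+1)) /entry.
have E : forall S A B C : V, S - A + fsum a q + B - C + io (a q.+1)
    = S - A + fsum a q.+1 + B - C.
  by move=> S A B C; rewrite fsumS !addrA; do 2 rewrite [_ + io _ in LHS]addrAC.
have M : (lam i)%:Z - q%:Z - i%:Z + j%:Z - 1 = (lam i)%:Z - q.+1%:Z - i%:Z + j%:Z by lia.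
by rewrite !E !M.
Qed.

(** The letter [b j.+1] cancels the last term of [fsum b j.+1]; this is how the preceding column
    arises. *)
Lemma entry_step_prev rj j q i : entry_step (b j.+1) rj j.+1 q i = entry lam s rj j q i.
Proof.
rewrite /entry_step /entry fsumS opprD -!addrA addNr addr0; congr (H _ _); lia.
Qed.

(** Uses [(1 + z t)/(1 - y t) = 1 + (y + z) t/(1 - y t)] for the letter [v]. *)
Lemma entry_letter v j q i : (v <= s i)%N ->
  entry lam s v j q i
  = entry lam s v.+1 j q i + (y v + z v) * entry_step (y v) v.+1 j q i.
Proof.
move=> le_vs; rewrite /entry /entry_step big_ltn ?ltnS //.
set S := \sum_(_ <= _ < _) _; set m := _ + j%:Z.
have -> : L v + S - fsum a (lam i).-1 + fsum a q + fsum b i - fsum b j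
    = S - fsum a (lam i).-1 + fsum a q + fsum b i - fsum b j + L v.
  by rewrite -!addrA addrC !addrA.
by rewrite H_letter (H_addU m (_ - fsum b j) (y v)); ring.
Qed.

(* Both sides equal (y - b) (H_{m-1}[Z + b + y] + z H_{m-2}[Z + b + y]). *)
Lemma entry_prev_letter v j q i : (v <= s i)%N ->
  (y v + z v) * entry_step (y v) v.+1 j.+1 q i
    - (b j.+1 + z v) * entry_step (b j.+1) v.+1 j.+1 q i
  = (y v - b j.+1) * entry lam s v j q i.
Proof.
move=> le_vs; rewrite entry_letter // -entry_step_prev /entry_step.
set Z := _ - fsum b j.+1; set m := _ - 1.
rewrite (H_addU m (Z + io (y v)) (b j.+1)) (H_addU m (Z + io (b j.+1)) (y v)).
set m' := _ + j%:Z - 1.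
have -> : m' = m - 1 by rewrite /m /m'; lia.
have -> : \sum_(v.+1 <= k < (s i).+1) L k - fsum a (lam i).-1 + fsum a q + fsum b i
    - fsum b j + io (y v) = Z + io (y v) + io (b j.+1).
  by rewrite /Z fsumS opprD [RHS]addrAC -!addrA [- io _ + _]addrA addNr add0r.
by rewrite [Z + io (b j.+1) + _]addrAC; ring.
Qed.
End Entries.

Definition flag_det n (lam mu r s : nat -> nat) : R :=
  \det (\matrix_(i < n, j < n) entry lam s (r j) j (mu j) i).

Definition floor_flag v (r : nat -> nat) j := maxn v (r j).

(** Only the conditions on [nu] and [r] are built in; run ends that violate [lam] or [s] are
    eliminated later by the vanishing of the determinant. *)
Definition step_weight (nu r : nat -> nat) v j q : R :=
  if (q < nu j)%N || (q != nu j) && (v < r j)%N then 0 else strip_weight y z a b nu v j q.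

Section Step.
Variables (n Q v : nat) (lam nu r s : nat -> nat).
Hypothesis nu_dec : forall i, (nu i.+1 <= nu i)%N.
Hypothesis r_inc : forall i, (i.+1 < n)%N -> (r i <= r i.+1)%N.
Hypothesis s_ge : forall i, (i < n)%N -> (v <= s i)%N.
Hypothesis lam_Q : forall i, (i < n)%N -> (lam i + n <= Q)%N.
Hypothesis nu_Q : forall i, (nu i <= Q)%N.

Let col j q (i : 'I_n) := entry lam s (floor_flag v.+1 r j) j q i.
(** [Q] bounds all run ends, so no cell of row 0 counts as having an equal cell above it. *)
Let above j := if j is j'.+1 then nu j' else Q.

Lemma strip_weightE j q : (q <= Q)%N ->
  strip_weight y z a b nu v j q = run_weight a (y v) (z v) (b j) (above j) (nu j) q.
Proof.
move=> le_qQ; apply: eq_big_nat => l /andP[_ lt_lq]; congr (_ + _).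
case: j {lt_lq} (leq_trans lt_lq le_qQ) => //= lt_lQ.
by rewrite leqNgt lt_lQ.
Qed.

Lemma above_bounds j : (nu j <= above j <= Q)%N.
Proof. by case: j => [|j] /=; rewrite ?nu_dec ?nu_Q ?leqnn. Qed.

Lemma entry_step_large u rj j i : (i < n)%N -> (j < n)%N ->
  entry_step lam s u rj j Q i = 0.
Proof. by move=> lt_in lt_jn; apply: H_lt0; have := lam_Q lt_in; lia. Qed.

Lemma step_sum j k (i : 'I_n) : (r j <= v)%N -> (nu j <= k)%N ->
  \sum_(q < Q.+1 | (k <= q)%N) step_weight nu r v j q * col j q i
  = \sum_(k <= q < Q.+1)
      run_weight a (y v) (z v) (b j) (above j) (nu j) q * col j q i.
Proof.
move=> r_le le_k; rewrite (big_nat_widenl _ _ _ _ _ (leq0n k)) big_mkord.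
apply: eq_bigr => q le_kq; rewrite /step_weight.
rewrite ltnNge (leq_trans le_k le_kq) ltnNge r_le andbF /=.
by rewrite strip_weightE // -ltnS.
Qed.

(** This is the cancellation hypothesis of [det_sum_chains]: [run_tail] gives a multiple of
    [entry_step] at [b j.+1], which is an entry of column [j]. *)
Lemma step_tail j m : (j.+1 < n)%N -> (nu j <= m)%N -> exists kap, forall i,
  \sum_(q < Q.+1 | (m < q)%N) step_weight nu r v j.+1 q * col j.+1 q i = kap * col j m i.
Proof.
move=> lt_jn le_num; have [le_Qm|lt_mQ] := leqP Q m.
  exists 0 => i; rewrite mul0r big1 // => q lt_mq.
  by have := leq_trans lt_mq (leq_trans (leq_ord q) le_Qm); rewrite ltnn.
have [lt_vr|le_rv] := ltnP v (r j.+1).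
  exists 0 => i; rewrite mul0r big1 // => q lt_mq; rewrite /step_weight lt_vr andbT.
  by rewrite (_ : _ || _) ?mul0r //; have := nu_dec j; lia.
exists ((\prod_(nu j.+1 <= t < m) ((if (nu j <= t)%N then b j.+1 else y v) - a t.+1))
  * (b j.+1 + z v)) => i.
rewrite (step_sum (k := m.+1)) //; last by rewrite (leq_trans (nu_dec j)) // ltnW.
rewrite (run_tail _ _ (d := fun q => entry_step lam s (b j.+1) (floor_flag v.+1 r j.+1) j.+1 q i)) /=.
(* Here [r j <= r j.+1 <= v], so both columns have lower flag [v.+1]. *)
- congr (_ * _); rewrite entry_step_prev /col /floor_flag.
  by congr (entry _ _ _ _ _); have := r_inc lt_jn; lia.
- by move=> q; apply: entry_stepE.
- by apply: entry_step_large.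
- by rewrite nu_dec.
- exact: ltnW.
Qed.

(** The multiple of the preceding column left over by [run_sum] and [entry_prev_letter]. *)
Let gamma j : R := if (r j <= v)%N then
    - (\prod_(nu j <= t < above j) (y v - a t.+1)) * (y v - b j) else 0.

Lemma step_column j (i : 'I_n) : (j < n)%N ->
  \sum_(q < Q.+1) step_weight nu r v j q * col j q i
  = entry lam s (floor_flag v r j) j (nu j) i
    + (if j is j'.+1 then gamma j * entry lam s (floor_flag v r j') j' (nu j') i else 0).
Proof.
move=> lt_jn; rewrite /gamma.
have [le_rv|lt_vr] := leqP (r j) v; last first.
  rewrite (bigD1 (Ordinal (nu_Q j : nu j < Q.+1)%N)) //= big1 => [|q neq_q].
    rewrite /step_weight ltnn eqxx /= /strip_weight big_geq // mul1r /col addr0.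
    rewrite /floor_flag (maxn_idPr lt_vr) (maxn_idPr (ltnW lt_vr)).
    by case: (j) => [|j']; rewrite ?mul0r addr0.
  by rewrite /step_weight -val_eqE /= in neq_q *; rewrite neq_q lt_vr orbT mul0r.
have floor j' : (r j' <= v)%N -> floor_flag v r j' = v by move/maxn_idPl.
have floorS j' : (r j' <= v)%N -> floor_flag v.+1 r j' = v.+1.
  by move=> le; apply/maxn_idPl/leqW.
rewrite (bigID (fun q : 'I_Q.+1 => (nu j <= q)%N)) /= [X in _ + X]big1 => [|q lt_q]; last first.
  by rewrite /step_weight ltnNge lt_q mul0r.
rewrite addr0 step_sum // (@run_sum _ a (y v) (z v) (b j) (fun q => col j q i)
  (fun q => entry_step lam s (y v) v.+1 j q i) (fun q => entry_step lam s (b j) v.+1 j q i)); first last.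
- exact: above_bounds.
- exact: entry_step_large.
- by move=> q; rewrite /col floorS //; apply: entry_stepE.
- by move=> q; rewrite /col floorS //; apply: entry_stepE.
rewrite /col floorS // floor // [entry lam s v j _ _]entry_letter ?s_ge //.
case: j => [|j] in lt_jn le_rv *; last first.
  rewrite entry_prev_letter ?s_ge // (floor j) ?(leq_trans (r_inc lt_jn)) //=.
  by rewrite -[in RHS]mulrA mulNr.
(* In the first column the correction is evaluated at [Q], where the degrees are negative. *)
by rewrite /above !entry_step_large // !mulr0 subrr mulr0 subr0 addr0.
Qed.

Lemma flag_det_step :
  flag_det n lam nu (floor_flag v r) s
  = \sum_(f : {ffun 'I_n -> 'I_Q.+1} | chain_upto n f)
      \prod_(j < n) step_weight nu r v j (f j)
      * flag_det n lam (fn f) (floor_flag v.+1 r) s.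
Proof.
transitivity (\det (\matrix_(i < n, j < n)
    \sum_(q < Q.+1) step_weight nu r v j q * col j q i)); last first.
  rewrite (det_sum_chains (nu := nu)).
  - apply: eq_bigr => f _; congr (_ * \det _); apply/matrixP => i j.
    by rewrite !mxE fnE.
  - by move=> j q lt_q; rewrite /step_weight lt_q.
  - exact: step_tail.
(* Right multiplication by the unitriangular [U] adds [gamma j] times the preceding column to column
   [j]. *)
pose U : 'M[R]_n := \matrix_(k, j) ((k == j)%:R + (k.+1 == j)%:R * gamma j).
have -> : \matrix_(i < n, j < n) \sum_(q < Q.+1) step_weight nu r v j q * col j q i
    = (\matrix_(i < n, j < n) entry lam s (floor_flag v r j) j (nu j) i) *m U.
  apply/matrixP => i j; rewrite !mxE step_column //.
  under [RHS]eq_bigr => k _ do rewrite !mxE mulrDr.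
  rewrite big_split /= (bigD1 j) //= eqxx mulr1 big1 ?addr0 => [|k /negPf->]; last by rewrite mulr0.
  congr (_ + _); case: j => [[|j] lt_jn] /=.
    by rewrite big1 // => k _; rewrite mul0r mulr0.
  rewrite (bigD1 (Ordinal (ltnW lt_jn))) //= eqxx mul1r mulrC big1 ?addr0 // => k.
  by rewrite -val_eqE /= eqSS => /negPf->; rewrite mul0r mulr0.
rewrite det_mulmx -[\det U]det_tr [\det U^T]det_trig.
  rewrite big1 ?mulr1 // => k _; rewrite !mxE eqxx (gtn_eqF (ltnSn k)).
  by rewrite mul0r addr0.
apply/is_trig_mxP => k j lt_kj; rewrite !mxE -val_eqE /= gtn_eqF //.
by rewrite gtn_eqF ?mul0r ?addr0 // ltnW.
Qed.
End Step.

Section FlagDet.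
Variables (n : nat) (lam nu : nat -> nat).
Hypothesis lam_dec : forall i, (lam i.+1 <= lam i)%N.

Lemma flag_det_refl rf s : (forall i, (i < n)%N -> nu i = lam i) -> flag_det n lam nu rf s = 1.
Proof.
move=> eq_nu; rewrite /flag_det -det_tr det_trig.
  by rewrite big1 // => i _; rewrite !mxE eq_nu // entry_diag.
apply/is_trig_mxP => i j lt_ij; rewrite !mxE entry_neg // eq_nu //.
by have := decn_le lam_dec (ltnW lt_ij); lia.
Qed.

(** A full row [j] gives column [j] a 1 on the diagonal and zeros below, so each dead index is a
    block of its own, on which the upper flag has no influence. *)
Lemma flag_det_dead (dead : pred nat) rf s s' :
  (forall i j, (i <= j < n)%N -> dead j -> dead i) ->
  (forall i, (i < n)%N -> dead i -> nu i = lam i) ->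
  (forall i, (i < n)%N -> ~~ dead i -> s i = s' i) ->
  flag_det n lam nu rf s = flag_det n lam nu rf s'.
Proof.
move=> dead_le dead_nu eq_s; pose bl (i : 'I_n) := if dead i then i : nat else n.
have zero s0 (i j : 'I_n) : (bl j < bl i)%N -> entry lam s0 (rf j) j (nu j) i = 0.
  rewrite /bl; case: ifP => dj lt_ji; last first.
    by move: lt_ji; case: ifP => _; rewrite ?ltnn // ltnNge ltnW.
  have lt_ji' : (j < i)%N.
    case: ifP lt_ji => // di _; rewrite ltnNge; apply/negP => le_ij.
    by rewrite (dead_le _ j) ?le_ij /= in di.
  by rewrite entry_neg // dead_nu //; have := decn_le lam_dec (ltnW lt_ji'); lia.
apply: (@det_eq_blocks _ _ bl) => i j.
- rewrite /bl !mxE; case: ifP => di; case: ifP => dj eq_ij.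
  + by rewrite -eq_ij dead_nu // !entry_diag.
  + by have := ltn_ord i; lia.
  + by have := ltn_ord j; lia.
  + by rewrite /entry eq_s ?di.
- by rewrite mxE; apply: zero.
- by rewrite mxE; apply: zero.
Qed.

Hypothesis nu_dec : forall i, (nu i.+1 <= nu i)%N.

Lemma flag_det_sub0 rf s k : (k < n)%N -> (lam k < nu k)%N -> flag_det n lam nu rf s = 0.
Proof.
move=> lt_kn lt_k; rewrite /flag_det -det_tr.
apply: (@det_zero_block _ _ (Ordinal lt_kn)) => i j /= le_ik le_kj.
rewrite !mxE entry_neg //.
by have := decn_le nu_dec le_ik; have := decn_le lam_dec le_kj; lia.
Qed.

Lemma flag_det_empty rf s k : (k < n)%N -> (nu k < lam k)%N ->
  (forall i j, (i <= k <= j)%N -> (j < n)%N -> (s i < rf j)%N) ->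
  flag_det n lam nu rf s = 0.
Proof.
move=> lt_kn lt_k lt_s; apply: (@det_zero_block _ _ (Ordinal lt_kn)) => i j /= le_ik le_kj.
rewrite mxE entry_empty ?(leq_trans le_ik) ?lt_s ?le_ik //.
by have := decn_le nu_dec le_kj; have := decn_le lam_dec le_ik; lia.
Qed.
End FlagDet.

(** * Increasing flags: induction on the smallest value *)

Section Main.
Variables (C : finType) (ri cj : C -> nat) (N n : nat) (lam mu r s : nat -> nat).
Hypothesis cell_inj : forall c d, ri c = ri d -> cj c = cj d -> c = d.
Hypothesis cell_row : forall c, (ri c < n)%N.
Hypothesis cell_col : forall c, (mu (ri c) <= cj c < lam (ri c))%N.
Hypothesis cell_ex : forall i j, (i < n)%N -> (mu i <= j < lam i)%N ->
  exists c, ri c = i /\ cj c = j.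
Hypothesis lam_dec : forall i, (lam i.+1 <= lam i)%N.
Hypothesis mu_dec : forall i, (mu i.+1 <= mu i)%N.
Hypothesis mu_lam : forall i, (i < n)%N -> (mu i <= lam i)%N.
Hypothesis r_inc : forall i, (i.+1 < n)%N -> (r i <= r i.+1)%N.
Hypothesis s_inc : forall i, (i.+1 < n)%N -> (s i <= s i.+1)%N.
Hypothesis r_gt0 : forall i, (i < n)%N -> (0 < r i)%N.
Hypothesis s_N : forall c, (s (ri c) <= N)%N.

(** Bounds all inner partitions that occur, also beyond index [n], and makes the degree of
    [entry_step] negative at [Q]. *)
Let Q := (lam 0 + mu 0 + n)%N.

Let s_le i j : (i <= j < n)%N -> (s i <= s j)%N.
Proof.
move=> /andP[/subnK <-]; elim: (j - i)%N => // k IHk lt_n.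
exact: leq_trans (IHk (ltnW lt_n)) (s_inc lt_n).
Qed.

Section Level.
Variables (v : nat) (nu : nat -> nat).
Hypothesis v_gt0 : (0 < v)%N.
Hypothesis nu_dec : forall i, (nu i.+1 <= nu i)%N.
Hypothesis nu_bounds : forall i, (i < n)%N -> (mu i <= nu i <= lam i)%N.
Hypothesis nu_Q : forall i, (nu i <= Q)%N.

Let mu_nu i : (i < n)%N -> (mu i <= nu i)%N. Proof. by case/nu_bounds/andP. Qed.
Let nu_lam i : (i < n)%N -> (nu i <= lam i)%N. Proof. by case/nu_bounds/andP. Qed.

(** Row [o] has cells left but no admissible value, so there is no filling; as [s] increases, the
    rows above have no letters either, and the determinant has a zero block. *)
Lemma frozen_g_det_empty o : (o < n)%N -> (s o < v)%N -> (nu o < lam o)%N ->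
  frozen_g ri cj N y z a b r s nu v = flag_det n lam nu (floor_flag v r) s.
Proof.
move=> lt_on lt_s lt_nu.
rewrite (flag_det_empty lam_dec nu_dec lt_on lt_nu) => [|i j /andP[le_io le_oj] lt_jn]; last first.
  by rewrite (leq_ltn_trans (s_le _) (leq_trans lt_s (leq_maxl _ _))) // le_io lt_on.
have [c [ri_c cj_c]] : exists c, ri c = o /\ cj c = nu o.
  by apply: cell_ex => //; rewrite mu_nu.
apply: big_pred0 => T; apply/negP => /andP[_ /forallP/(_ c)].
rewrite ri_c cj_c ltnn geq_max => /andP[/andP[le_v _] le_s].
by have := leq_trans le_v le_s; rewrite leqNgt lt_s.
Qed.

Hypothesis dead_nu : forall i, (i < n)%N -> (s i < v)%N -> nu i = lam i.

Lemma frozen_g_det_end : v = N.+1 ->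
  frozen_g ri cj N y z a b r s nu v = flag_det n lam nu (floor_flag v r) s.
Proof.
move=> v_k.
have nu_eq i : (i < n)%N -> nu i = lam i.
  move=> lt_in; apply/eqP; rewrite eqn_leq nu_lam //= leqNgt; apply/negP => lt_nu.
  have [c [ri_c _]] : exists c, ri c = i /\ cj c = nu i by apply: cell_ex => //; rewrite mu_nu.
  have := s_N c; rewrite ri_c -ltnS -v_k => /(dead_nu lt_in) eq_nu.
  by move: lt_nu; rewrite eq_nu ltnn.
have in_nu c : (cj c < nu (ri c))%N.
  by rewrite nu_eq //; case/andP: (cell_col c).
rewrite (flag_det_refl lam_dec) // /frozen_g (big_pred1 [ffun=> ord0]) => [|T].
  by rewrite big_pred0 // => c; rewrite leqNgt in_nu.
apply/andP/eqP => [[_ /forallP T0]|->].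
  by apply/ffunP => c; apply: val_inj; rewrite ffunE; have := T0 c; rewrite in_nu => /eqP.
split; last by apply/forallP => c; rewrite in_nu ffunE.
by apply/forallP => c; apply/forallP => d; rewrite !ffunE implybT.
Qed.

Lemma frozen_g_det_step : (v <= N)%N ->
  (forall nu', (forall i, (nu' i.+1 <= nu' i)%N) ->
     (forall i, (i < n)%N -> (mu i <= nu' i <= lam i)%N) -> (forall i, (nu' i <= Q)%N) ->
     frozen_g ri cj N y z a b r s nu' v.+1 = flag_det n lam nu' (floor_flag v.+1 r) s) ->
  frozen_g ri cj N y z a b r s nu v = flag_det n lam nu (floor_flag v r) s.
Proof.
move=> v_N IHv.
(* [flag_det_step] needs upper flags at least [v]; rows with a smaller one are full, so their flags
   may be raised. *)
pose s' i := maxn v (s i).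
have deadE nu' : (forall i, (i < n)%N -> (s i < v)%N -> nu' i = lam i) ->
    forall rf, flag_det n lam nu' rf s = flag_det n lam nu' rf s'.
  move=> eq_nu' rf; apply: (flag_det_dead lam_dec (dead := fun i => (s i < v)%N)) => // [i j le_ij|i _].
    exact/leq_ltn_trans/s_le.
  by rewrite -leqNgt /s' => /maxn_idPr->.
rewrite (deadE nu) // (flag_det_step (Q := Q)) //; first last.
- by move=> i lt_in; rewrite /Q; have := decn_le lam_dec (leq0n i); lia.
- by move=> i _; apply: leq_maxl.
have lam_Q i : (i < n)%N -> (lam i <= Q)%N.
  by move=> lt_in; rewrite /Q; have := decn_le lam_dec (leq0n i); lia.
rewrite (frozen_g_step _ _ _ _ _ _ cell_inj cell_row cell_col cell_ex lam_dec lam_Q) //.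
rewrite [RHS](bigID (extends (n := n) (Q := Q) r s lam nu v)) /=.
(* Any other [f] contributes 0: below [nu] or against [r] by its weight, beyond [lam] by the
   determinant; growth against [s] would take a full row beyond [lam]. *)
rewrite [X in _ = _ + X]big1 ?addr0 => [|f /andP[ch_f]]; last first.
  rewrite /extends ch_f => /forallPn[i]; rewrite -fnE.
  have [lt_nu _|le_nu] := ltnP (fn f i) (nu i).
    by rewrite (bigD1 i) //= /step_weight -fnE lt_nu !mul0r.
  have [lt_lam _|le_lam] /= := ltnP (lam i) (fn f i).
    by rewrite (flag_det_sub0 lam_dec (fn_dec ch_f) _ _ (ltn_ord i) lt_lam) mulr0.
  rewrite negb_imply negb_and -!ltnNge => /andP[neq /orP[lt_r|lt_s]].
    by rewrite (bigD1 i) //= /step_weight -fnE neq lt_r orbT !mul0r.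
  by case/eqP: neq; apply/eqP; rewrite eqn_leq le_nu dead_nu ?le_lam.
apply: eq_big => f; first by rewrite andb_idl // => /andP[].
move=> ext_f; have /andP[ch_f /forallP bounds] := ext_f.
have f_bounds i : (i < n)%N -> (nu i <= fn f i <= lam i)%N.
  by move=> lt_in; have := bounds (Ordinal lt_in); rewrite -fnE => /andP[].
congr (_ * _).
  apply: eq_bigr => j _; have /andP[/andP[le_nu _] /implyP flag] := bounds j.
  rewrite /step_weight ltnNge le_nu /=; case: eqP => //= /eqP neq.
  by have /andP[le_r _] := flag neq; rewrite ltnNge le_r.
rewrite -deadE => [|i lt_in lt_s]; last first.
  by apply/eqP; rewrite eqn_leq -{2}(dead_nu lt_in) // andbC; apply: f_bounds.
apply: IHv => //.
- exact: fn_dec.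
- by move=> i lt_in; have /andP[le_nu ->] := f_bounds i lt_in; rewrite (leq_trans (mu_nu lt_in)).
- move=> i; have [lt_in|le_ni] := ltnP i n; last by rewrite fn_out.
  by rewrite (fnE f (Ordinal lt_in)) -ltnS.
Qed.

End Level.

Lemma frozen_g_det k v nu :
  (v + k = N.+1)%N -> (0 < v)%N -> (forall i, (nu i.+1 <= nu i)%N) ->
  (forall i, (i < n)%N -> (mu i <= nu i <= lam i)%N) -> (forall i, (nu i <= Q)%N) ->
  frozen_g ri cj N y z a b r s nu v = flag_det n lam nu (floor_flag v r) s.
Proof.
elim: k v nu => [|k IHk] v nu v_k v_gt0 nu_dec nu_bounds nu_Q;
  have [/existsP[o /andP[lt_s lt_nu]]|no] :=
    boolP [exists o : 'I_n, (s o < v)%N && (nu o < lam o)%N];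
  try by apply: (@frozen_g_det_empty _ _ _ _ o).
all: have dead_nu i : (i < n)%N -> (s i < v)%N -> nu i = lam i
  by (move=> lt_in lt_s; apply/eqP; rewrite eqn_leq; have /andP[_ ->] /= := nu_bounds i lt_in;
      rewrite leqNgt; apply/negP => lt_nu; case/existsP: no; exists (Ordinal lt_in); rewrite lt_s).
  by apply: frozen_g_det_end => //; rewrite -v_k addn0.
apply: frozen_g_det_step => // [|nu' *]; first by rewrite -ltnS -v_k addnS ltnS leq_addr.
by apply: IHk => //; rewrite addSnnS.
Qed.

Lemma super_g_det : super_g ri cj N y z a b r s = flag_det n lam mu r s.
Proof.
transitivity (flag_det n lam mu (floor_flag 1 r) s); last first.
  rewrite /flag_det; congr (\det _); apply/matrixP => i j; rewrite !mxE /floor_flag.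
  by rewrite (maxn_idPr _) ?r_gt0.
rewrite -(@frozen_g_det N) //; first last.
- move=> i; rewrite /Q; have := decn_le mu_dec (leq0n i); lia.
- by move=> i lt_in; rewrite leqnn mu_lam.
have out c : (cj c < mu (ri c))%N = false by have := cell_col c; lia.
apply: eq_big => [T|T _]; last by apply: eq_bigl => c; rewrite leqNgt out.
congr (_ && _); apply: eq_forallb => c; rewrite out.
by rewrite geq_max; have := r_gt0 (cell_row c); lia.
Qed.
End Main.
End Plethystic.

(** * Conditionally increasing flags *)

(** The values live in ordinals of different sizes, so the cellwise bijections are given on naturals
    and need to be inverse only on admissible fillings. Serves both the shift of the alphabets and
    the reversal of the values. *)
Lemma reindex_values (A : nmodType) (C : finType) N N' (phi psi : C -> nat -> nat)
    (P : pred {ffun C -> 'I_N.+1}) (P' : pred {ffun C -> 'I_N'.+1}) F F' :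
  (forall T, P T -> forall c, (phi c (T c) <= N')%N /\ psi c (phi c (T c)) = T c) ->
  (forall T', P' T' -> forall c, (psi c (T' c) <= N)%N /\ phi c (psi c (T' c)) = T' c) ->
  (forall (T : {ffun C -> 'I_N.+1}) (T' : {ffun C -> 'I_N'.+1}),
     (forall c, T' c = phi c (T c) :> nat) ->
     (forall c, T c = psi c (T' c) :> nat) -> P T = P' T' /\ (P T -> F T = F' T')) ->
  \sum_(T | P T) F T = \sum_(T' | P' T') F' T' :> A.
Proof.
move=> phiP psiP eqPF.
pose h (T' : {ffun C -> 'I_N'.+1}) : {ffun C -> 'I_N.+1} := [ffun c => inord (psi c (T' c))].
pose h' (T : {ffun C -> 'I_N.+1}) : {ffun C -> 'I_N'.+1} := [ffun c => inord (phi c (T c))].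
have h'E T : P T -> forall c, h' T c = phi c (T c) :> nat.
  by move=> PT c; rewrite ffunE inordK // ltnS; case: (phiP T PT c).
have hE T' : P' T' -> forall c, h T' c = psi c (T' c) :> nat.
  by move=> PT c; rewrite ffunE inordK // ltnS; case: (psiP T' PT c).
have hK T : P T -> h (h' T) = T.
  move=> PT; apply/ffunP => c; apply: val_inj; rewrite ffunE h'E //.
  by have [_ ->] := phiP T PT c; rewrite inord_val.
have relP T : P T -> P T = P' (h' T) /\ (P T -> F T = F' (h' T)).
  move=> PT; apply: eqPF => c; first exact: h'E.
  by rewrite h'E //; have [_ ->] := phiP T PT c.
rewrite (reindex_onto h h') //; apply: eq_big => [T'|T' /andP[PT /eqP eqT']].
  apply/andP/idP => [[PT /eqP eqT']|PT'].
    by have [+ _] := relP _ PT; rewrite PT eqT' => <-.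
  have [eqP' _] := eqPF (h T') T' (fun c => esym (etrans (f_equal (phi c) (hE T' PT' c))
    (proj2 (psiP T' PT' c)))) (hE T' PT').
  rewrite eqP' PT'; split => //; apply/eqP/ffunP => c; apply: ord_inj.
  by rewrite h'E ?eqP' // hE //; have [_ ->] := psiP T' PT' c.
by have [_ /(_ PT)] := relP _ PT; rewrite eqT'.
Qed.

Section ConditionalFlags.
Variables (R : comNzRingType) (V : zmodType) (H : int -> V -> R) (io : R -> V).
Hypothesis H_addU : forall m Z u, H m Z = H m (Z + io u) - u * H (m - 1) (Z + io u).
Hypothesis H_dom0 : forall m, H m 0 = (m == 0)%:R.
Hypothesis H_lt0 : forall m Z, (m < 0) -> H m Z = 0.
Hypothesis H_0 : forall Z, H 0 Z = 1.
Variables (L : nat -> V) (y z a b : nat -> R).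
Hypothesis H_letter : forall k m Z,
  H m (Z + L k) = H m (Z + io (y k)) + z k * H (m - 1) (Z + io (y k)).
Variables (C : finType) (ri cj : C -> nat) (N n : nat) (lam mu r s : nat -> nat).
Hypothesis cell_inj : forall c d, ri c = ri d -> cj c = cj d -> c = d.
Hypothesis cell_row : forall c, (ri c < n)%N.
Hypothesis cell_col : forall c, (mu (ri c) <= cj c < lam (ri c))%N.
Hypothesis cell_ex : forall i j, (i < n)%N -> (mu i <= j < lam i)%N ->
  exists c, ri c = i /\ cj c = j.
Hypothesis lam_dec : forall i, (lam i.+1 <= lam i)%N.
Hypothesis mu_dec : forall i, (mu i.+1 <= mu i)%N.
Hypothesis mu_lam : forall i, (i < n)%N -> (mu i <= lam i)%N.
Hypothesis rs_inc : forall i, (i.+1 < n)%N -> (mu i < lam i.+1)%N ->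
  (r i <= r i.+1)%N /\ (s i <= s i.+1)%N.
Hypothesis r_gt0 : forall i, (i < n)%N -> (0 < r i)%N.
Hypothesis s_N : forall c, (s (ri c) <= N)%N.

(* Rows [i] and [i + 1] share a column iff [mu i < lam i.+1]. Giving each maximal
   group of rows linked in this way a fresh copy of the alphabet makes the flags
   globally increasing. *)
Let bl i := count (fun k => lam k.+1 <= mu k)%N (iota 0 i).
Let K := (\max_(i < n) maxn (r i) (s i)).+1.
Let shift (f : nat -> nat) i := (f i + K * bl i)%N.

Let blS i : bl i.+1 = (bl i + (lam i.+1 <= mu i))%N.
Proof. by rewrite /bl -[in LHS](addn1 i) iotaD count_cat /= add0n addn0. Qed.

Let bl_le i j : (i <= j)%N -> (bl i <= bl j)%N.
Proof.
move/subnK <-; elim: (j - i)%N => // k IHk.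
by rewrite addSn blS (leq_trans IHk) ?leq_addr.
Qed.

Let bl_lt j i : (bl j < bl i)%N -> (j < i)%N /\ (lam i <= mu j)%N.
Proof.
move=> lt_bl; have lt_ji : (j < i)%N.
  by rewrite ltnNge; apply/negP => /bl_le; rewrite leqNgt lt_bl.
split=> //; elim: i lt_bl lt_ji => // i IHi; rewrite blS ltnS => lt_bl le_ji.
case: (leqP (lam i.+1) (mu i)) lt_bl => [le_lam _|_].
  exact: leq_trans le_lam (decn_le mu_dec le_ji).
rewrite addn0 => lt_bl; apply: leq_trans (lam_dec i) (IHi lt_bl _).
by rewrite ltn_neqAle le_ji andbT; apply/eqP => eq_ji; rewrite eq_ji ltnn in lt_bl.
Qed.

Let bl_n i : (bl i <= i)%N.
Proof. by rewrite -[X in (_ <= X)%N](size_iota 0 i) count_size. Qed.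

Let flag_K i : (i < n)%N -> (r i < K)%N /\ (s i < K)%N.
Proof.
move=> lt_in; have := leq_bigmax (F := fun i : 'I_n => maxn (r i) (s i)) (Ordinal lt_in).
by rewrite /K !ltnS geq_max => /andP.
Qed.

Let cell_bl c d : cj c = cj d -> (ri c <= ri d)%N -> bl (ri c) = bl (ri d).
Proof.
move=> eq_cj le_cd; apply/eqP; rewrite eqn_leq bl_le //= leqNgt; apply/negP => /bl_lt[_ le].
by have := cell_col c; have := cell_col d; lia.
Qed.

(** Within a block the shifts cancel, and reduction modulo [K], which exceeds all flags, recovers
    the letters; below the diagonal blocks all degrees are negative. *)
Let shift_flag_det :
  flag_det H io (fun k => L (k %% K)%N) a b n lam mu (shift r) (shift s)
  = flag_det H io L a b n lam mu r s.
Proof.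
apply: (@det_eq_blocks _ _ bl) => i j.
- move=> eq_bl; rewrite !mxE /entry /shift eq_bl big_addn subSn ?leq_addl // addnK.
  congr (H _ (_ - _ + _ + _ - _)); apply: eq_big_nat => k /andP[_ le_ks].
  have [_ lt_K] := flag_K (ltn_ord i).
  by rewrite addnC mulnC modnMDl modn_small // (leq_ltn_trans _ lt_K).
- move=> /bl_lt[lt_ji le]; rewrite mxE (entry_neg io H_lt0) //; lia.
- move=> /bl_lt[lt_ji le]; rewrite mxE (entry_neg io H_lt0) //; lia.
Qed.

(** Comparisons only involve cells sharing a row or a column, hence rows of the same block, where
    the shift is constant. *)
Let shift_super_g :
  super_g ri cj N y z a b r s
  = super_g ri cj (K * n.+1) (fun k => y (k %% K)%N) (fun k => z (k %% K)%N) a b (shift r) (shift s).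
Proof.
apply: (reindex_values (phi := fun c t => (t + K * bl (ri c))%N)
                       (psi := fun c t => (t - K * bl (ri c))%N)).
- move=> T /andP[_ /forallP/(_ _)/andP flags] c; rewrite addnK; split=> //.
  have [_ le_s] := flags c; have [_ lt_K] := flag_K (cell_row c).
  by rewrite mulnS leq_add ?(leq_trans le_s (ltnW lt_K)) // leq_mul2l
     (leq_trans (bl_n _) (ltnW (cell_row c))) orbT.
- move=> T /andP[_ /forallP/(_ _)/andP flags] c; have [le_r le_s] := flags c.
  rewrite subnK; last by apply: leq_trans le_r; apply: leq_addl.
  by split=> //; apply: leq_trans (s_N c); rewrite leq_subLR addnC.
move=> T T' TE _; have Tle c d : bl (ri c) = bl (ri d) -> (T' c <= T' d)%N = (T c <= T d)%N.
  by move=> eq_bl; rewrite !TE eq_bl leq_add2r.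
have Teq c d : bl (ri c) = bl (ri d) -> (T' c == T' d) = (T c == T d).
  by move=> eq_bl; rewrite -!val_eqE /= !TE eq_bl eqn_add2r.
split.
  congr (_ && _).
    apply: eq_forallb => c; apply: eq_forallb => d.
    have [le_cd|//] := boolP (cell_le ri cj c d); rewrite !implyTb Tle //.
    case/orP: le_cd => /andP[/eqP eq_cd le_cd]; [by rewrite eq_cd|exact: cell_bl].
  by apply: eq_forallb => c; rewrite TE /shift !leq_add2r.
case/andP=> _ /forallP flags; apply: eq_bigr => c _; rewrite /super_wt.
have -> : (T' c %% K)%N = T c.
  rewrite TE addnC mulnC modnMDl modn_small //; have /andP[_ le_s] := flags c.
  by have [_] := flag_K (cell_row c); apply: leq_ltn_trans.
have -> : eq_up ri cj T' c = eq_up ri cj T c.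
  apply: eq_existsb => d; case: eqP => //= ri_c; case: eqP => //= cj_d.
  by rewrite Teq //; apply: cell_bl; rewrite // ri_c.
have -> // : eq_next ri cj T' c = eq_next ri cj T c.
by apply: eq_existsb => d; case: eqP => //= ri_d; rewrite Teq ?ri_d.
Qed.

Theorem super_g_flag_det :
  super_g ri cj N y z a b r s = flag_det H io L a b n lam mu r s.
Proof.
rewrite shift_super_g -shift_flag_det.
(* Between blocks the shift grows by [K], which exceeds every flag. *)
have shift_inc (f : nat -> nat) i : (i.+1 < n)%N -> (f i < K)%N ->
    ((mu i < lam i.+1)%N -> (f i <= f i.+1)%N) -> (shift f i <= shift f i.+1)%N.
  move=> lt_in lt_K f_inc; rewrite /shift blS.
  case: (leqP (lam i.+1) (mu i)) f_inc => /= [_ _|_ /(_ isT) le_f]; last by rewrite addn0 leq_add2r.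
  by rewrite mulnDr muln1; lia.
apply: (super_g_det H_addU H_dom0 H_lt0 H_0) => //.
- by move=> i lt_in; have [lt_K _] := flag_K (ltnW lt_in); apply: shift_inc => // /(rs_inc lt_in)[].
- by move=> i lt_in; have [_ lt_K] := flag_K (ltnW lt_in); apply: shift_inc => // /(rs_inc lt_in)[].
- by move=> i lt_in; rewrite addn_gt0 r_gt0.
- move=> c; have [_ lt_K] := flag_K (cell_row c).
  by rewrite mulnS leq_add ?(ltnW lt_K) // leq_mul2l (leq_trans (bl_n _) (ltnW (cell_row c))) orbT.
Qed.
End ConditionalFlags.

(** * Rows and columns *)

(** Rows and columns are reversed by the same permutation, whose sign appears twice. *)
Lemma det_rev_tr (R : comNzRingType) n (A B : 'M[R]_n) :
  (forall i j, B i j = A (rev_ord j) (rev_ord i)) -> \det B = \det A.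
Proof.
move=> BE; pose s : 'S_n := perm (@rev_ord_inj n).
have -> : B = (col_perm s (row_perm s A))^T.
  by apply/matrixP => i j; rewrite !mxE !permE BE.
rewrite det_tr col_permE row_permE !det_mulmx !det_perm odd_permV.
by rewrite mulrAC -signr_addb addbb mul1r.
Qed.

Lemma big_rev_complement (V : zmodType) (f : nat -> V) K p q : (q <= K)%N -> (p <= K)%N ->
  \sum_(K - q <= k < (K - p).+1) f (K - k)%N = \sum_(p <= k < q.+1) f k.
Proof.
move=> le_qK le_pK; have [lt_qp|le_pq] := ltnP q p.
  by rewrite !big_geq //; lia.
elim: q le_qK le_pq => [|q IHq] le_qK le_pq.
  have -> : p = 0%N by lia.
  by rewrite !big_nat1 subn0 subnn.
rewrite big_ltn; last by lia.
rewrite subKn //; have [->|neq] := eqVneq p q.+1.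
  by rewrite big_geq ?big_nat1 ?addr0 //; lia.
rewrite [RHS]big_nat_recr /=; last by lia.
rewrite -IHq; [|lia..].
by rewrite addrC (_ : (K - q.+1).+1 = K - q)%N //; lia.
Qed.

(** * Partitions, conjugates and marks *)

Lemma nth_part_dec l : is_part l -> forall i, (nth 0 l i.+1 <= nth 0 l i)%N.
Proof.
move=> /(sortedP 0%N) part_l i; have [lt_i|le_i] := ltnP i.+1 (size l); first exact: part_l.
by rewrite nth_default.
Qed.

Lemma nth_le_head l : is_part l -> forall i, (nth 0 l i <= head 0 l)%N.
Proof. by move=> /nth_part_dec dec i; rewrite -nth0; apply: decn_le. Qed.

(** The parts exceeding [j] form an initial segment of [l], so there are more than [i] of them
    exactly when the part at [i] is one. *)
Lemma nth_conj_part l : is_part l ->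
  forall i j, (i < nth 0 (conj_part l) j)%N = (j < nth 0 l i)%N.
Proof.
move=> part_l i j; have -> : nth 0%N (conj_part l) j = count (fun p => j < p)%N l.
  have [lt_j|le_j] := ltnP j (head 0%N l); first by rewrite nth_mkseq.
  rewrite nth_default ?size_mkseq //; apply/esym/eqP; rewrite -leqn0 leqNgt -has_count.
  apply/hasP => -[p /(nthP 0%N)[k _ <-]]; apply/negP; rewrite -leqNgt.
  exact: leq_trans (nth_le_head part_l k) le_j.
elim: l part_l i => [|p l IHl] part_l i; first by rewrite nth_nil.
have part_l' : is_part l by exact: path_sorted part_l.
rewrite [count _ _]/=; case: (ltnP j p) => [lt_jp|le_pj].
  by case: i => [|i] //=; rewrite add1n ltnS IHl.
have small k : (nth 0 (p :: l) k <= j)%N.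
  exact: leq_trans (nth_le_head part_l k) le_pj.
rewrite add0n [RHS]ltnNge small; apply/negbTE; rewrite -leqNgt.
have := IHl part_l' 0%N; rewrite [X in _ = X]ltnNge (small 1%N) /= lt0n => /negbFE/eqP->.
by [].
Qed.

Lemma conj_part_sorted l : is_part l -> is_part (conj_part l).
Proof.
move=> part_l; apply/(sortedP 0%N) => i _; rewrite /= leqNgt; apply/negP => lt.
have := nth_conj_part part_l (nth 0%N (conj_part l) i) i.+1.
by rewrite lt => /esym/ltnW; rewrite -nth_conj_part // ltnn.
Qed.

Section Marks.
Variables (nu rho : seq nat) (N : nat) (T : {ffun cell nu rho -> 'I_N}).
Variables (R : comNzRingType) (x a b : nat -> R).

(** The product of sums expands over all sets [M] of cells; a set with a cell that cannot be marked
    picks up a factor 0. *)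
Lemma sum_marks :
  \sum_(M : {set cell nu rho} | is_mrpp T M) wt T M x a b
  = if is_rpp T then
      \prod_c ((if eq_above T c then b (crow c) else x (T c))
               + (if eq_right T c then - a (ccol c).+1 else 0))
    else 0.
Proof.
rewrite /is_mrpp; case: (is_rpp T) => /=; last exact: big_pred0_eq.
under [RHS]eq_bigr => c _ do rewrite addrC.
rewrite bigA_distr [RHS](bigID (fun M : {set _} => [forall c in M, eq_right T c])) /=.
rewrite [X in _ + X]big1 ?addr0 => [|M /forallPn[c]]; last first.
  by rewrite negb_imply => /andP[cM /negPf not_eq]; rewrite (bigD1 c) //= cM not_eq mul0r.
apply: eq_bigr => M /forallP marked; apply: eq_bigr => c _; rewrite /cell_wt.
by case: ifP => // cM; rewrite (implyP (marked c)).
Qed.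
End Marks.

Lemma g_boundedE nu rho (R : comNzRingType) (x a b : nat -> R) lo hi :
  g_bounded (nu := nu) (rho := rho) x a b lo hi
  = if part_sub rho nu then
      \sum_(T : {ffun cell nu rho -> 'I_(\max_c hi c).+1} |
              [forall c, (lo c <= T c <= hi c)%N] && is_rpp T)
        \prod_c ((if eq_above T c then b (crow c) else x (T c))
                 + (if eq_right T c then - a (ccol c).+1 else 0))
    else 0.
Proof.
rewrite /g_bounded; case: ifP => // _; rewrite [RHS]big_mkcondr.
by apply: eq_bigr => T _; apply: sum_marks.
Qed.

Lemma part_subP rho nu :
  reflect (forall i, (nth 0 rho i <= nth 0 nu i)%N) (part_sub rho nu).
Proof.
apply: (iffP allP) => [le_rho i|le_rho i _]; last exact: le_rho.
have [lt_i|le_i] := ltnP i (size rho); last by rewrite nth_default.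
by apply: le_rho; rewrite mem_iota.
Qed.

Lemma part_sub_conj rho nu : is_part rho -> is_part nu ->
  part_sub (conj_part rho) (conj_part nu) = part_sub rho nu.
Proof.
move=> part_rho part_nu; apply/part_subP/part_subP => le i; rewrite leqNgt; apply/negP.
  move=> lt; have := nth_conj_part part_rho i (nth 0 nu i); rewrite lt => lt'.
  have := leq_trans lt' (le _); rewrite nth_conj_part // ltnn //.
move=> lt; have := nth_conj_part part_rho (nth 0 (conj_part nu) i) i.
rewrite lt => /esym lt'; have := leq_trans lt' (le _).
by rewrite -nth_conj_part // ltnn.
Qed.

Section Cells.
Variables nu rho : seq nat.
Implicit Types c d : cell nu rho.

Lemma cell_bounds c : (nth 0 rho (crow c) <= ccol c < nth 0 nu (crow c))%N.
Proof. exact: (valP c). Qed.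

Lemma crow_size c : (crow c < size nu)%N.
Proof. exact: ltn_ord. Qed.

Lemma cell_eq c d : crow c = crow d -> ccol c = ccol d -> c = d.
Proof.
move=> eq_r eq_c; apply: val_inj; apply/eqP.
by rewrite -pair_eqE /=; apply/andP; split; apply/eqP/ord_inj.
Qed.

Lemma cell_exists i j : is_part nu -> (nth 0 rho i <= j < nth 0 nu i)%N ->
  exists c, crow c = i /\ ccol c = j.
Proof.
move=> part_nu /andP[le_j lt_j].
have lt_i : (i < size nu)%N by rewrite ltnNge; apply/negP => /(nth_default 0%N) E; rewrite E in lt_j.
have lt_h : (j < head 0 nu)%N by apply: leq_trans lt_j (nth_le_head part_nu i).
have in_c : in_skew rho (Ordinal lt_i, Ordinal lt_h) by rewrite /in_skew /= le_j lt_j.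
by exists (exist (fun c : 'I_(size nu) * 'I_(head 0%N nu) => in_skew rho c) _ in_c).
Qed.
End Cells.

(** * The two determinantal formulas *)

Section Final.
Variables (R : comNzRingType) (x a b : nat -> R) (n : nat) (lam mu r s : n.-tuple nat).
Hypothesis lam_part : is_part lam.
Hypothesis mu_part : is_part mu.
Hypothesis r_pos : forall i : 'I_n, (0 < tnth r i)%N.
Hypothesis rs_le : forall i : nat, (i.+1 < n)%N ->
  (nth 0%N mu i < nth 0%N lam i.+1)%N ->
  (nth 0%N r i <= nth 0%N r i.+1)%N /\ (nth 0%N s i <= nth 0%N s i.+1)%N.

Let part (l : n.-tuple nat) : nat -> nat := nth 0%N l.
Let lam_dec i : (part lam i.+1 <= part lam i)%N. Proof. exact: nth_part_dec. Qed.
Let mu_dec i : (part mu i.+1 <= part mu i)%N. Proof. exact: nth_part_dec. Qed.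
Let r_gt0 i : (i < n)%N -> (0 < part r i)%N.
Proof. by move=> lt_in; have := r_pos (Ordinal lt_in); rewrite (tnth_nth 0%N). Qed.

Let crow_n (c : cell lam mu) : (crow c < n)%N.
Proof. exact: leq_trans (crow_size c) (eq_leq (size_tuple lam)). Qed.

Lemma not_part_sub : ~~ part_sub mu lam -> exists2 k, (k < n)%N & (part lam k < part mu k)%N.
Proof.
move=> no; have /existsP[k lt_k] : [exists k : 'I_n, (part lam k < part mu k)%N].
  rewrite -[X in is_true X]negbK negb_exists; apply: contra no => /forallP le.
  apply/part_subP => i; have [lt_in|le_ni] := ltnP i n.
    by have := le (Ordinal lt_in); rewrite -leqNgt.
  by rewrite nth_default // size_tuple.
by exists k.
Qed.

Lemma g_row_det : g_row lam mu x a b r s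
  = flag_det (@h R) (fun u => << u >>) (fun k => << x k >>) a b n
      (part lam) (part mu) (part r) (part s).
Proof.
have lt0 m Z : m < 0 -> h m Z = 0 :> R by case: m.
rewrite /g_row g_boundedE; case: ifP => [/part_subP mu_lam|/negbT/not_part_sub[k lt_kn lt_k]]; last first.
  by rewrite (flag_det_sub0 _ lt0 _ _ _ lam_dec mu_dec _ _ lt_kn lt_k).
rewrite -(@super_g_flag_det _ _ _ _ (@h_addU R) (@h_dom0 R) lt0 (@h_m0 R) _ x (fun=> 0) a b _ _
  (@crow lam mu) (@ccol lam mu) (\max_(c : cell lam mu) nth 0%N s (crow c))) //.
- apply: eq_bigl => T; apply/andP/andP => [[flags /andP[_ mon]]|[mon flags]]; split=> //.
  apply/andP; split=> //; apply/forallP => c; have /andP[le_r _] := forallP flags c.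
  exact: leq_trans (r_gt0 (crow_n c)) le_r.
- by move=> k m Z; rewrite mul0r addr0.
- exact: cell_eq.
- exact: cell_bounds.
- by move=> i j _; apply: cell_exists.
- by move=> i _; apply: mu_lam.
- by move=> c; apply: (leq_bigmax (F := fun c : cell lam mu => nth 0%N s (crow c))).
Qed.

Notation ccell := (cell (conj_part lam) (conj_part mu)).

Let ccell_bounds (c : ccell) : (part mu (ccol c) <= crow c < part lam (ccol c))%N.
Proof.
have := cell_bounds c; rewrite leqNgt !nth_conj_part //.
by rewrite -leqNgt.
Qed.

Let ccol_n (c : ccell) : (ccol c < n)%N.
Proof.
rewrite ltnNge; apply/negP => le_n; have /andP[_] := ccell_bounds c.
by rewrite /part nth_default // size_tuple.
Qed.

Let M := (head 0%N lam).+1.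
Let N : nat := \max_(c : ccell) nth 0%N s (ccol c).
(** Large enough for the subtractions in [flip] and in the reversal of values to be exact. *)
Let N1 := (N + \max_(i < n) maxn (part r i) (part s i))%N.

(* The shape [lam / mu] rotated by 180 degrees inside an [n * M] rectangle. *)
Let rot (l : n.-tuple nat) i := if (i < n)%N then (M - part l (n - i.+1))%N else 0%N.
Let flip (f : n.-tuple nat) i := (N1.+1 - part f (n - i.+1))%N.
Let rot_row (c : ccell) := (n - (ccol c).+1)%N.
Let rot_col (c : ccell) := (M - (crow c).+1)%N.
(** The index [M] would give [b 0], replaced by 0; it is reached at zero parts of [lam], where the
    formula has a truncated predecessor. *)
Let rot_a k := if (k < M)%N then - b (M - k)%N else 0.
Let rot_b k := - a (n - k)%N.
Let rot_x k := x (N1.+1 - k)%N.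

Let rot_rowK c : (n - (rot_row c).+1)%N = ccol c.
Proof. by rewrite /rot_row; have := ccol_n c; lia. Qed.

Let rot_row_n c : (rot_row c < n)%N.
Proof. by rewrite /rot_row; have := ccol_n c; lia. Qed.

Let rot_dec l : (forall i, (part l i.+1 <= part l i)%N) ->
  forall i, (rot l i.+1 <= rot l i)%N.
Proof.
move=> l_dec i; rewrite /rot; case: ltnP => // lt_in; rewrite (ltnW lt_in).
by have := l_dec (n - i.+2)%N; rewrite subnSK //; lia.
Qed.

Let flag_N1 i : (i < n)%N -> (part r i <= N1)%N /\ (part s i <= N1)%N.
Proof.
move=> lt_in; have := leq_bigmax (F := fun i : 'I_n => maxn (part r i) (part s i)) (Ordinal lt_in).
by rewrite geq_max => /andP[le_r le_s]; split; [apply: leq_trans le_r _|apply: leq_trans le_s _];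
  apply: leq_addl.
Qed.

Let lam_M i : (part lam i < M)%N. Proof. exact: nth_le_head. Qed.

(** Transposing and rotating exchanges the neighbour above with the one to the right, hence the
    roles of [a] and [b]; reversing the values keeps fillings increasing and exchanges lower and
    upper flags. *)
Let rot_super_g :
  super_g rot_row rot_col N1 (fun=> 0) rot_x rot_a rot_b (flip s) (flip r)
  = \sum_(T : {ffun ccell -> 'I_N.+1} |
              [forall c, (nth 0%N r (ccol c) <= T c <= nth 0%N s (ccol c))%N] && is_rpp T)
        \prod_c ((if eq_above T c then b (crow c) else x (T c))
                 + (if eq_right T c then - a (ccol c).+1 else 0)).
Proof.
apply/esym; apply: (reindex_values (phi := fun _ t => (N1.+1 - t)%N) (psi := fun _ t => (N1.+1 - t)%N)).
- move=> T /andP[/forallP flags _] c; have /andP[le_r _] := flags c.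
  have := r_gt0 (ccol_n c); rewrite /part => r_gt; have := leq_ord (T c).
  by rewrite /N1; split; lia.
- move=> T /andP[_ /forallP flags] c; have := flags c; rewrite /flip rot_rowK.
  have [le_r le_s] := flag_N1 (ccol_n c); have := r_gt0 (ccol_n c).
  have := leq_bigmax (F := fun c : ccell => nth 0%N s (ccol c)) c.
  by rewrite -/N /part in le_r le_s *; split; lia.
move=> T T' TE _.
have T_N1 c : (T c <= N1)%N by have := leq_ord (T c); rewrite /N1; lia.
have Tle c d : (T' c <= T' d)%N = (T d <= T c)%N.
  by rewrite !TE; have := T_N1 c; have := T_N1 d; lia.
have Teq c d : (T' c == T' d) = (T c == T d).
  apply/eqP/eqP => eq_cd; apply: ord_inj; last by rewrite !TE eq_cd.
  by have := f_equal (@nat_of_ord _) eq_cd; rewrite !TE; have := T_N1 c; have := T_N1 d; lia.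
have cellE c d : cell_le rot_row rot_col c d
    = ((crow d == crow c) && (ccol d <= ccol c)%N || (ccol d == ccol c) && (crow d <= crow c)%N).
  rewrite /cell_le /rot_row /rot_col; have := ccol_n c; have := ccol_n d.
  by have := ccell_bounds c; have := ccell_bounds d; have := lam_M (ccol c); have := lam_M (ccol d); lia.
split.
  have flagE c : (flip s (rot_row c) <= T' c <= flip r (rot_row c))%N
      = (nth 0%N r (ccol c) <= T c <= nth 0%N s (ccol c))%N.
    rewrite TE /flip rot_rowK; have := T_N1 c.
    by have [le_r le_s] := flag_N1 (ccol_n c); rewrite /part in le_r le_s *; lia.
  have monE : monotone rot_row rot_col T' = [forall c, forall d,
      ((crow c == crow d) && (ccol c <= ccol d)%N ||
       (ccol c == ccol d) && (crow c <= crow d)%N) ==> (T c <= T d)%N].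
    by apply/forallP/forallP => mon c; apply/forallP => d;
      have /forallP/(_ c) := mon d; rewrite cellE Tle.
  rewrite /is_rpp -monE; apply/andP/andP => [[flags /andP[_ mon]]|[mon flags]]; split=> //.
  - by apply/forallP => c; rewrite flagE; apply: (forallP flags).
  - by apply/forallP => c; rewrite -flagE; apply: (forallP flags).
  apply/andP; split=> //; apply/forallP => c.
  have := forallP flags c; rewrite flagE => /andP[le_r _].
  exact: leq_trans (r_gt0 (ccol_n c)) le_r.
move=> _; apply: eq_bigr => c _; rewrite /super_wt addrC.
have c_M := lam_M (ccol c); have c_n := ccol_n c; have c_bounds := ccell_bounds c.
have -> : eq_up rot_row rot_col T' c = eq_right T c.
  apply: eq_existsb => d; rewrite Teq andbA [RHS]andbA; congr (_ && _).
  have d_M := lam_M (ccol d); have d_n := ccol_n d; have d_bounds := ccell_bounds d.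
  by rewrite /rot_row /rot_col; lia.
have -> : eq_next rot_row rot_col T' c = eq_above T c.
  apply: eq_existsb => d; rewrite Teq andbA [RHS]andbA; congr (_ && _).
  have d_M := lam_M (ccol d); have d_n := ccol_n d; have d_bounds := ccell_bounds d.
  by rewrite /rot_row /rot_col; lia.
congr (_ + _).
  by case: ifP => // _; rewrite /rot_b; congr (- a _); rewrite /rot_row; lia.
case: ifP => [/existsP[d /and3P[/eqP eq_c _ _]]|_].
  rewrite /rot_a; case: ltnP => [_|]; last by rewrite /rot_col; lia.
  by rewrite opprK; congr (b _); rewrite /rot_col; lia.
by rewrite /rot_x TE; congr (x _); have := T_N1 c; lia.
Qed.

(** The [e]-series of [- << - u >>] is [1/(1 - u t)], which gives [e] the recurrence assumed of
    [H]. *)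
Let io (u : R) : {freeg R / int} := - << - u >>.

Let e_io m Z u : e m Z = e m (Z + io u) - u * e (m - 1) (Z + io u).
Proof. by rewrite -[Z in LHS](subrK << - u >>) e_addU mulNr. Qed.

Let e_io0 m Z : e m (Z + io 0) = e m Z.
Proof. by rewrite [RHS](e_io _ _ 0) mul0r subr0. Qed.

Let sum_rev (f : nat -> R) K j : (j < K)%N ->
  \sum_(1 <= k < (K - j.+1).+1) << f (K - k)%N >> = psum f K.-1 - psum f j.
Proof.
move=> lt_jK; have := @big_rev_complement _ (fun k => << f k >> : {freeg R / int}) K j.+1 K.-1.
rewrite -subn1 subKn ?(leq_ltn_trans _ lt_jK) // leq_subr => ->//.
rewrite /psum /alph subn1 prednK ?(leq_ltn_trans _ lt_jK) //.
by rewrite [in RHS](big_cat_nat _ (n := j.+1)) //= addrAC subrr add0r.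
Qed.

(** Initial sums of reversed parameters differ from those of the originals by a full sum, which
    cancels between the two occurrences in [entry]. *)
Let fsum_rot_b i : (i < n)%N -> fsum io rot_b i = psum a (n - i.+1) - psum a n.-1.
Proof.
move=> lt_in; rewrite -opprB -(sum_rev _ (_ : (n - i.+1 < n)%N)); last by lia.
rewrite /fsum -sumrN (_ : n - (n - i.+1).+1 = i)%N; last by lia.
by apply: eq_bigr => k _; rewrite /io /rot_b opprK.
Qed.

Let fsum_rot_a j : (j < M)%N -> fsum io rot_a (M - j.+1) = psum b j - psum b M.-1.
Proof.
move=> lt_jM; rewrite -opprB -(sum_rev _ lt_jM) /fsum -sumrN.
apply: eq_big_nat => k /andP[_ lt_k]; rewrite /io /rot_a (_ : k < M)%N ?opprK //; lia.
Qed.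

(** Holds only under [e]: for [j = 0] there is an extra term [io 0], a nonzero formal sum with
    series 1. *)
Let e_fsum_rot_a m Z j : (j < M)%N ->
  e m (Z + fsum io rot_a (M - j)) = e m (Z + (psum b j.-1 - psum b M.-1)).
Proof.
case: j => [_|j lt_jM]; last by rewrite fsum_rot_a // ltnW.
rewrite subn0 -[M in fsum _ _ M]/((head 0%N lam).+1) fsumS.
have -> : head 0%N lam = (M - 1)%N by rewrite subn1.
by rewrite fsum_rot_a // addrA /rot_a /M subn1 ltnn e_io0.
Qed.

Lemma g_col_det : g_col (conj_part lam) (conj_part mu) x a b r s
  = flag_det (@e R) io (fun k => << rot_x k >>) rot_a rot_b n
      (rot mu) (rot lam) (flip s) (flip r).
Proof.
have lt0 m Z : m < 0 -> e m Z = 0 :> R by case: m.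
rewrite /g_col g_boundedE part_sub_conj //.
case: ifP => [/part_subP mu_lam|/negbT/not_part_sub[k lt_kn lt_k]]; last first.
  have lt_rot : (rot mu (n - k.+1) < rot lam (n - k.+1))%N.
    rewrite /rot (_ : n - k.+1 < n)%N; last by lia.
    by rewrite (_ : n - (n - k.+1).+1 = k)%N; [have := lam_M k; lia|lia].
  by rewrite (flag_det_sub0 _ lt0 _ _ _ (rot_dec mu_dec) (rot_dec lam_dec) _ _ _ lt_rot) //; lia.
rewrite -rot_super_g.
apply: (@super_g_flag_det _ _ _ _ e_io (@e_dom0 R) lt0 (@e_m0 R)) => //.
- by move=> k m Z; rewrite !e_io0 e_addU.
- move=> c d; have := ccol_n c; have := ccol_n d.
  have := ccell_bounds c; have := ccell_bounds d; have := lam_M (ccol c); have := lam_M (ccol d).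
  by rewrite /rot_row /rot_col => *; apply: cell_eq; lia.
- move=> c; rewrite /rot rot_row_n rot_rowK /rot_col.
  by have := ccell_bounds c; have := lam_M (ccol c); lia.
- move=> i j lt_in; rewrite /rot lt_in => bounds_j; set k := (n - i.+1)%N in bounds_j.
  have lt_kM := lam_M k.
  have [c [row_c col_c]] : exists c : ccell, crow c = (M - j.+1)%N /\ ccol c = k.
    apply: cell_exists; last by rewrite leqNgt !nth_conj_part // -/(part _ _) -/(part _ _); lia.
    exact: conj_part_sorted.
  by exists c; rewrite /rot_row /rot_col row_c col_c /k; lia.
- exact: rot_dec.
- exact: rot_dec.
- by move=> i lt_in; rewrite /rot lt_in; have := mu_lam (n - i.+1)%N; rewrite /part; lia.
- move=> i lt_in; rewrite /rot lt_in (ltnW lt_in) => lt_rot.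
  have := @rs_le (n - i.+2)%N; rewrite subnSK // -/(part _ _) -/(part _ _) => /(_ _ _) [].
  + by lia.
  + by have := lam_M (n - i.+1)%N; have := lam_M (n - i.+2)%N; rewrite /part in lt_rot *; lia.
  by rewrite /flip /part => le_r le_s; split; lia.
- by move=> i lt_in; rewrite /flip; have := @flag_N1 (n - i.+1)%N; lia.
- by move=> c; rewrite /flip rot_rowK; have := r_gt0 (ccol_n c); lia.
Qed.

Lemma rot_flag_det : part_sub mu lam ->
  flag_det (@e R) io (fun k => << rot_x k >>) rot_a rot_b n (rot mu) (rot lam) (flip s) (flip r)
  = \det (\matrix_(i < n, j < n)
      e ((tnth lam i)%:Z - (tnth mu j)%:Z - i%:Z + j%:Z)
        (alph x (tnth r j) (tnth s i) - psum a i + psum a j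
         + psum b (tnth lam i).-1 - psum b (tnth mu j))).
Proof.
move/part_subP => mu_lam; apply: det_rev_tr => i j; rewrite !mxE !(tnth_nth 0%N) /=.
rewrite -!/(part _ _); set i' := (n - i.+1)%N; set j' := (n - j.+1)%N.
have lam_Mj := lam_M j'; have lam_Mi := lam_M i'; have mu_Mi : (part mu i' <= part lam i')%N := mu_lam i'.
have lt_rev (k : 'I_n) : (n - k.+1 < n)%N by have := ltn_ord k; lia.
have [le_r _] := flag_N1 (lt_rev i); have [_ le_s] := flag_N1 (lt_rev j).
rewrite /entry /rot !ltn_ord -/i' -/j'.
set S := \sum_(_ <= _ < _) _.
have -> : S = alph x (part r i') (part s j').
  rewrite /S /flip -/i' -/j' /alph -(@big_rev_complement _ (fun k => << x k >>) N1.+1) //; exact: leqW.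
have -> : (M - part mu i').-1 = (M - (part mu i').+1)%N by lia.
rewrite fsum_rot_a ?(leq_ltn_trans mu_Mi) // !fsum_rot_b // -/i' -/j'.
set A := psum b (part mu i') - _; set B := fsum _ _ _; set C := psum a i' - _.
set D := psum a j' - _.
have -> : alph x (part r i') (part s j') - A + B + C - D
    = alph x (part r i') (part s j') - A + C - D + B.
  by rewrite [_ + B + C]addrAC [_ + B - D]addrAC.
rewrite e_fsum_rot_a //; congr (e _ _).
  have iE : (i' + i.+1 = n)%N by rewrite subnK.
  have jE : (j' + j.+1 = n)%N by rewrite subnK.
  by lia.
apply/eqP/freeg_eqP => w; rewrite /A /C /D !(coeffD, coeffN); ring.
Qed.

End Final.

Theorem theorem7p5 (R : comNzRingType) (x a b : nat -> R) (n : nat)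
    (lam mu r s : n.-tuple nat)
    (lam_part : is_part lam) (mu_part : is_part mu)
    (r_pos : forall i : 'I_n, (0 < tnth r i)%N)
    (s_pos : forall i : 'I_n, (0 < tnth s i)%N)
    (rs_le : forall i : nat, (i.+1 < n)%N ->
       (nth 0%N mu i < nth 0%N lam i.+1)%N ->
       (nth 0%N r i <= nth 0%N r i.+1)%N /\ (nth 0%N s i <= nth 0%N s i.+1)%N) :
  g_row lam mu x a b r s
  = \det (\matrix_(i < n, j < n)
      h ((tnth lam i)%:Z - (tnth mu j)%:Z - i%:Z + j%:Z)
        (alph x (tnth r j) (tnth s i)
         - psum a (tnth lam i).-1 + psum a (tnth mu j)
         + psum b i - psum b j))
  /\
  g_col (conj_part lam) (conj_part mu) x a b r s
  = \det (\matrix_(i < n, j < n)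
      e ((tnth lam i)%:Z - (tnth mu j)%:Z - i%:Z + j%:Z)
        (alph x (tnth r j) (tnth s i)
         - psum a i + psum a j
         + psum b (tnth lam i).-1 - psum b (tnth mu j))).
Proof.
split.
  rewrite g_row_det //; congr (\det _); apply/matrixP => i j.
  by rewrite !mxE !(tnth_nth 0%N).
have [sub|no] := boolP (part_sub mu lam); first by rewrite g_col_det // rot_flag_det.
(* [rot_flag_det] assumes containment; without it the determinant vanishes because of a block of
   negative degrees. *)
rewrite /g_col g_boundedE part_sub_conj // (negPf no); apply/esym.
have [k lt_kn lt_k] := not_part_sub no; rewrite -det_tr.
apply: (@det_zero_block _ _ (Ordinal lt_kn)) => i j /= le_ik le_kj.
rewrite !mxE !(tnth_nth 0%N).
have := decn_le (nth_part_dec mu_part) le_ik; have := decn_le (nth_part_dec lam_part) le_kj.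
move=> le_lam le_mu; case E : (_ + _ : int) => [m|//]; exfalso.
by move: E; lia.
Qed.
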